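(* Let $X$ be a good random variable with rate function $\Lambda_*$. Let $K_n=([n],\binom{[n]}{2})$ be the complete undirected graph, and assign to each edge $e$ a weight $X_e$, where the $X_e$ are independent copies of $X$. For a set $\mathscr{C}_n$ of subgraphs of $K_n$ let \[ W_n=\max\Big\{\sum_{e\in E(H)}X_e:\ H\in\mathscr{C}_n\Big\}. \] (a)–(c): If $\mathscr{C}_n$ is (a) the set of all spanning trees of $K_n$, or (b) the set of all Hamilton cycles of $K_n$, or (c) the set of all paths from vertex $1$ to vertex $2$ in $K_n$, then $W_n=(1+o(1))\,n\,\Lambda_*^{-1}(\log n)$ with high probability, i.e. there is a deterministic sequence $\varepsilon_n\to0$ with $\mathbb{P}\big((1-\varepsilon_n)n\Lambda_*^{-1}(\log n)\le W_n\le(1+\varepsilon_n)n\Lambda_*^{-1}(\log n)\big)\to1$. (d): If $\mathscr{C}_n$ is the set of all copies in $K_n$ of a fixed balanced graph $H_0$ with $\ell\ge1$ edges and density $d$, then $W_n=(1+o(1))\,\ell\,\Lambda_*^{-1}(d^{-1}\log n)$ with high probability, i.e. there is a deterministic sequence $\varepsilon_n\to0$ with $\mathbb{P}\big((1-\varepsilon_n)\ell\Lambda_*^{-1}(d^{-1}\log n)\le W_n\le(1+\varepsilon_n)\ell\Lambda_*^{-1}(d^{-1}\log n)\big)\to1$.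
   Context: For a random variable $X$, $\Lambda(t)=\log\mathbb{E}e^{tX}\in(-\infty,+\infty]$ and $\Lambda_*(t)=\sup_{s\in\mathbb{R}}\{st-\Lambda(s)\}$ (rate function). $X$ has regular upper tails if $\mathbb{P}(X>t)=\exp(-(1+o(1))\Lambda_*(t))$ as $t\to+\infty$ (vacuous when $X$ is bounded above). $X$ is good if it is symmetric, $\Lambda(t)<\infty$ for all $|t|<\delta$ for some $\delta>0$, and $X$ has regular upper tails. For $t\ge0$, $\Lambda_*^{-1}(t)=\inf\{s:\Lambda_*(s)\ge t\}$. The density of a graph $H=(V,E)$ is $d(H)=|E|/|V|$; $H$ is balanced if $d(H')\le d(H)$ for every subgraph $H'$ of $H$.
   Formalization: The infimum defining Λ_*^{-1}(t) is taken over s ≥ 0; over all real s it would be −∞, because Λ_* is even and tends to +∞ at −∞ for symmetric X (for example X = ±1 with probability 1/2 each). *)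

(* Defs.v *)
From HB Require Import structures.
From mathcomp Require Import all_boot all_order all_algebra.
From mathcomp Require Import all_classical all_reals all_analysis.
Set Implicit Arguments.
Unset Strict Implicit.
Unset Printing Implicit Defensive.
Import Order.TTheory GRing.Theory Num.Theory.
Import numFieldNormedType.Exports.

Local Open Scope classical_set_scope.
Local Open Scope ring_scope.

Definition log_mgf d (T : measurableType d) (R : realType)
    (P : probability T R) (X : T -> R) (t : R) : \bar R :=
  lne ('M_P X t).

Definition rate d (T : measurableType d) (R : realType)
    (P : probability T R) (X : T -> R) (t : R) : \bar R :=
  ereal_sup [set ((s * t)%:E - log_mgf P X s)%E | s in [set: R]].

(* The infimum is over s >= 0: for symmetric X the rate function is even, and an
   infimum over all of R would be -oo for every t. *)
Definition rate_inv d (T : measurableType d) (R : realType)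
    (P : probability T R) (X : T -> R) (t : R) : \bar R :=
  ereal_inf [set s%:E | s in [set s : R | 0 <= s /\ (t%:E <= rate P X s)%E]].

Definition same_law d d' (T : measurableType d) (T' : measurableType d')
    (R : realType) (P : probability T R) (X : T -> R)
    (P' : probability T' R) (Y : T' -> R) : Prop :=
  forall A : set R, measurable A -> P (X @^-1` A) = P' (Y @^-1` A).

Definition symmetric_rv d (T : measurableType d) (R : realType)
    (P : probability T R) (X : T -> R) : Prop :=
  same_law P X P (\- X).

Definition regular_upper_tails d (T : measurableType d) (R : realType)
    (P : probability T R) (X : T -> R) : Prop :=
  (forall M : R, (0 < P [set w | (M < X w)%R])%E) ->
  exists2 eps : R -> R,
    eps t @[t --> +oo] --> 0 &
    \forall t \near +oo,
      P [set w | t < X w] = expeR (- ((1 + eps t)%:E * rate P X t))%E.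

Definition good d (T : measurableType d) (R : realType)
    (P : probability T R) (X : T -> R) : Prop :=
  [/\ symmetric_rv P X,
      exists2 delta : R, 0 < delta &
        forall t, `|t| < delta -> (log_mgf P X t < +oo)%E
    & regular_upper_tails P X].

(* Mutual independence of the subfamily of X indexed by J. *)
Definition independent d (T : measurableType d) (R : realType)
    (P : probability T R) (I : finType) (J : {set I}) (X : I -> T -> R) : Prop :=
  forall (F : {set I}) (B : I -> set R), F \subset J ->
    (forall i, measurable (B i)) ->
    P [set w | forall i, i \in F -> B i (X i w)] =
    (\prod_(i in F) P (X i @^-1` B i))%E.

Definition whp_asymptotic (R : realType) (d : nat -> measure_display)
    (T : forall n, measurableType (d n)) (P : forall n, probability (T n) R)
    (W : forall n, T n -> \bar R) (a : nat -> \bar R) : Prop :=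
  exists2 eps : nat -> R,
    eps n @[n --> \oo] --> 0 &
    P n [set w | ((1 - eps n)%:E * a n <= W n w <= (1 + eps n)%:E * a n)%E]
      @[n --> \oo] --> 1%E.

(* A finite simple graph with vertices in T: a vertex set together with an edge
   set consisting of two-element subsets of the vertex set. *)
Definition wf_graph (T : finType) (G : {set T} * {set {set T}}) : bool :=
  [forall e in G.2, (#|e| == 2%N) && (e \subset G.1)].

Record graph (T : finType) := Graph {
  graph_val : {set T} * {set {set T}};
  graph_wf : wf_graph graph_val }.

HB.instance Definition _ (T : finType) := [isSub for @graph_val T].
HB.instance Definition _ (T : finType) := [Finite of graph T by <:].

Definition vertices (T : finType) (G : graph T) : {set T} := (graph_val G).1.
Definition edges (T : finType) (G : graph T) : {set {set T}} := (graph_val G).2.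

Definition subgraph (T : finType) (H G : graph T) : bool :=
  (vertices H \subset vertices G) && (edges H \subset edges G).

Definition density (T : finType) (G : graph T) : rat :=
  #|edges G|%:R / #|vertices G|%:R.

(* For the graph without vertices, density is 0 / 0 = 0, so it imposes nothing. *)
Definition balanced (T : finType) (G : graph T) : Prop :=
  forall H : graph T, subgraph H G -> density H <= density G.

Lemma wf_complete (T : finType) :
  wf_graph ([set: T]%SET, [set e : {set T} | #|e| == 2%N]%SET).
Proof. by apply/forall_inP => e; rewrite inE /= finset.subsetT andbT. Qed.

Definition complete_graph (T : finType) : graph T := Graph (wf_complete T).

Definition walk_edges (T : finType) (x : T) (p : seq T) : {set {set T}} :=
  [set:: pairmap (fun u v => [set u; v]%SET) x p].

Definition is_path_between (T : finType) (x y : T) (G : graph T) : Prop :=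
  exists p : seq T, [/\ uniq (x :: p), last x p = y,
    vertices G = [set:: x :: p] & edges G = walk_edges x p].

Definition is_cycle (T : finType) (G : graph T) : Prop :=
  exists x : T, exists p : seq T, [/\ (3 <= size (x :: p))%N, uniq (x :: p),
    vertices G = [set:: x :: p] & edges G = walk_edges x (rcons p x)].

Definition graph_connected (T : finType) (G : graph T) : Prop :=
  forall x y, x \in vertices G -> y \in vertices G ->
  exists2 Q : graph T, subgraph Q G & is_path_between x y Q.

Definition is_tree (T : finType) (G : graph T) : Prop :=
  [/\ (0 < #|vertices G|)%N, graph_connected G
    & forall C : graph T, subgraph C G -> ~ is_cycle C].

Definition spanning (T : finType) (G : graph T) : Prop :=
  vertices G = [set: T]%SET.

Definition is_copy (T0 T : finType) (H0 : graph T0) (H : graph T) : Prop :=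
  exists f : T0 -> T, [/\ {in vertices H0 &, injective f},
    vertices H = [set f x | x in vertices H0]%SET
  & edges H = [set [set f x | x in e] | e : {set T0} in edges H0]%SET].

Definition spanning_trees (n : nat) : set (graph 'I_n) :=
  [set H | spanning H /\ is_tree H].

Definition hamilton_cycles (n : nat) : set (graph 'I_n) :=
  [set H | spanning H /\ is_cycle H].

(* 'I_n is {0, .., n-1}: vertices 1 and 2 of [n] are the elements 0 and 1. *)
Definition paths_1_to_2 (n : nat) : set (graph 'I_n) :=
  [set H | exists x : 'I_n, exists y : 'I_n,
     [/\ x = 0%N :> nat, y = 1%N :> nat & is_path_between x y H]].

Definition copies (T0 : finType) (H0 : graph T0) (n : nat) : set (graph 'I_n) :=
  [set H | is_copy H0 H].

(* Equal to -oo when C is empty, which happens only for finitely many n for the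
   classes of subgraphs above. *)
Definition max_weight (R : realType) (T : finType) (C : set (graph T))
    (x : {set T} -> R) : \bar R :=
  \big[maxe/-oo%E]_(H : graph T | H \in C) (\sum_(e in edges H) x e)%:E.

(* Main.v *)
Require Import Defs.
From HB Require Import structures.
From mathcomp Require Import all_boot all_order all_algebra.
From mathcomp Require Import zify ring lra.
Set Implicit Arguments.
Unset Strict Implicit.
Unset Printing Implicit Defensive.
Import Order.TTheory GRing.Theory Num.Theory.

(* Upper bounds: Chernoff's inequality bounds the tail of a sum of at most [N]
   edge weights by exp (- N L) at level [N * rinv L],
   where [rinv] inverts the rate function. Spanning trees, Hamilton
   cycles and paths have at most [n] edges, and there are only (e n) ^ n sets of
   at most [n] edges, so a union bound over all of these handles the three classes
   at once; copies of a fixed graph on [v] vertices are at most [n ^ v] in number.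
   The factor 1 + eps passes from [L] to [rinv L] because the rate function is
   convex and vanishes at 0.

   Lower bounds: by regularity of the tail, an edge has weight at least
   (1 - eps) rinv L with probability at least exp (- (1 - c) L). For L = log n,
   with high probability any two disjoint vertex sets of size proportional to eps n
   are joined by such a heavy edge, hence depth-first search finds a heavy path
   covering most vertices. Completing it arbitrarily to a Hamilton path or cycle
   costs little, since all weights are at least - rinv (3 L). For copies of a
   balanced graph, the second moment method applies to the copies whose vertices
   lie in prescribed blocks of [n]. *)

(** The slack eps has to pay for each count of configurations. From above, passing from [L = log n]
    to [(1 + eps) L] gains a factor [n ^ (eps n)], which beats the factor [e ^ n] left over from the
    number of edge sets. From below, an edge is heavy with probability at least
    [p = n ^ (- (1 - c))]; for m proportional to eps n the exponent [p m ^ 2] has order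
    [n ^ (1 + c)] and beats the at most [4 ^ n] pairs of vertex sets. With p of order 1 / n it would
    only be of order n with a small constant, so the gain c in the tail exponent is essential.

    Two obstacles shape the rest. Weights can be negative, so the edges that complete a heavy path
    are not free; symmetry turns upper tail bounds into lower ones. And the rate function can jump,
    even to infinity, so its value at [rinv L] may be smaller than L: estimates are available only
    strictly beyond [rinv L], and strict inequalities and limits replace evaluation at that
    point. *)

(** * Paths, cycles and trees *)

(* Depth-first search, with finished set [S], stack [p] and unvisited set [U]:
   there is never an [r]-edge from [S] to [U], and each step decreases
   [#|U| - #|S|] by one.  When the two sizes agree, both are less than [m]. *)
Lemma sorted_dfs (T : finType) (r : rel T) (A : {set T}) (m : nat) :
  symmetric r ->
  (forall S U : {set T}, S \subset A -> U \subset A -> [disjoint S & U] ->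
     #|S| = m -> #|U| = m -> exists u v, [/\ u \in S, v \in U & r u v]) ->
  exists p : seq T, [/\ uniq p, {subset p <= A}, sorted r p
    & #|A| <= size p + m.*2].
Proof.
move=> r_sym hr.
suff H k : k <= #|A| -> exists S U : {set T}, exists p : seq T,
    [/\ [/\ S \subset A, U \subset A & {subset p <= A}],
        [/\ uniq p, sorted r p, [disjoint S & U], {in p, forall v, v \notin S}
          & {in p, forall v, v \notin U}],
        #|S| + size p + #|U| = #|A|,
        {in S & U, forall s u, ~~ r s u} & #|U| = #|S| + (#|A| - k)].
  have [S [U [p [[SA UA pA] [up sp SU pS pU] cA nr]]]] := H _ (leqnn _).
  rewrite subnn addn0 => cUS; exists p; split => //.
  have [mS|Sm] := leqP m #|S|; last first.
    by rewrite -cA cUS -addnn; lia.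
  have /set0Pn [S'] : [set B : {set T} | B \subset S & #|B| == m] != set0.
    by rewrite -card_gt0 cards_draws bin_gt0.
  rewrite inE => /andP[S'S /eqP cS'].
  have /set0Pn [U'] : [set B : {set T} | B \subset U & #|B| == m] != set0.
    by rewrite -card_gt0 cards_draws bin_gt0 cUS.
  rewrite inE => /andP[U'U /eqP cU'].
  have [|||u [v [uS vU]]] := hr S' U' _ _ _ cS' cU'.
  - exact: subset_trans SA.
  - exact: subset_trans UA.
  - by apply: disjointW SU.
  - by rewrite (negPf (nr _ _ (subsetP S'S _ uS) (subsetP U'U _ vU))).
elim: k => [_|k IH kA].
  exists set0, A, [::]; split => //.
  - by split; rewrite ?sub0set.
  - by split => //; rewrite disjoints_subset sub0set.
  - by rewrite cards0.
  - by move=> s u; rewrite inE.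
  - by rewrite cards0 subn0.
have [S [U [p [[SA UA pA] [up sp SU pS pU] cA nr cUS]]]] := IH (ltnW kA).
have U_gt0 : 0 < #|U| by rewrite cUS addn_gt0 subn_gt0 kA orbT.
have push u : u \in U -> sorted r (u :: p) ->
    exists S U : {set T}, exists p : seq T,
    [/\ [/\ S \subset A, U \subset A & {subset p <= A}],
        [/\ uniq p, sorted r p, [disjoint S & U], {in p, forall v, v \notin S}
          & {in p, forall v, v \notin U}],
        #|S| + size p + #|U| = #|A|,
        {in S & U, forall s u, ~~ r s u} & #|U| = #|S| + (#|A| - k.+1)].
  move=> uU sup; exists S, (U :\ u), (u :: p).
  have cU : #|U| = (#|U :\ u|).+1 by rewrite (cardsD1 u U) uU.
  split.
  - split => //; first by apply: subset_trans UA; exact: subD1set.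
    by move=> v; rewrite inE => /predU1P[->|/pA //]; exact: (subsetP UA).
  - split => //.
    + by rewrite /= up andbT; apply/negP => /pU; rewrite uU.
    + by apply: disjointWr SU; exact: subD1set.
    + move=> v; rewrite inE => /predU1P[->|/pS //].
      by apply/negP => uS; rewrite (disjointFl SU uU) in uS.
    + move=> v; rewrite inE => /predU1P[->|/pU /negPf vU].
        by rewrite !inE eqxx.
      by rewrite !inE vU andbF.
  - by rewrite /= -cA cU; lia.
  - by move=> s v sS; rewrite inE => /andP[_ vU]; exact: nr.
  - by apply: succn_inj; rewrite -cU cUS -addnS subnSK.
have [u uU] : exists u, u \in U by apply/set0Pn; rewrite -card_gt0.
case: p up sp pS pU pA cA push => [|v p] up sp pS pU pA cA push.
  exact: push uU _.
(* The top v of the stack either has an unvisited neighbour, which is pushed, or has none, and then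
   v can join S without creating an edge from S to U. *)
have [/existsP[w /andP[wU rvw]]|] := boolP [exists w, (w \in U) && r v w].
  by apply: push wU _; rewrite /= r_sym rvw.
rewrite negb_exists => /forallP nvU.
have vS : v \notin S by apply: pS; rewrite mem_head.
exists (v |: S), U, p; split.
- split => //; last by move=> w wp; apply: pA; rewrite inE wp orbT.
  by rewrite subUset sub1set SA andbT; apply: pA; rewrite mem_head.
- split.
  + by case/andP: up.
  + exact: path_sorted sp.
  + rewrite disjoints_subset subUset sub1set inE.
    by rewrite pU ?mem_head //= -disjoints_subset.
  + move=> w wp; rewrite !inE negb_or pS ?inE ?wp ?orbT// andbT.
    by apply: contraTneq wp => ->; case/andP: up.
  + by move=> w wp; apply: pU; rewrite inE wp orbT.
- by rewrite cardsU1 vS -cA /=; lia.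
- move=> s w; case/setU1P => [->|sS wU]; last exact: nr.
  by move=> wU; have := nvU w; rewrite wU.
- by rewrite cardsU1 vS cUS -(subnSK kA); lia.
Qed.

Section Walks.
Variable T : finType.
Implicit Types (x y u v : T) (p : seq T) (E : {set {set T}}) (G C : graph T).

Definition adj E : rel T := fun u v => [set u; v] \in E.

Lemma adj_sym E : symmetric (adj E).
Proof. by move=> u v; rewrite /adj setUC. Qed.

Lemma walk_edges_cons x y p :
  walk_edges x (y :: p) = [set x; y] |: walk_edges y p.
Proof. by rewrite /walk_edges /= set_cons. Qed.

Lemma walk_edges_nil x : walk_edges x [::] = set0.
Proof. by apply/setP => e; rewrite !inE. Qed.

Lemma walk_edges_rcons x p y :
  walk_edges x (rcons p y) = [set last x p; y] |: walk_edges x p.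
Proof.
elim: p x => [|z p IH] x; first by rewrite walk_edges_cons !walk_edges_nil.
by rewrite rcons_cons !walk_edges_cons IH /= setUCA.
Qed.

Lemma walk_edges_path E x p : path (adj E) x p = (walk_edges x p \subset E).
Proof.
elim: p x => [|y p IH] x /=; first by rewrite walk_edges_nil sub0set.
by rewrite IH walk_edges_cons subUset sub1set.
Qed.

Lemma path_walk_edges x p : path (adj (walk_edges x p)) x p.
Proof. by rewrite walk_edges_path. Qed.

Lemma sub_walk_edges x p e u :
  e \in walk_edges x p -> u \in e -> u \in x :: p.
Proof.
elim: p x => [|y p IH] x; first by rewrite walk_edges_nil inE.
rewrite walk_edges_cons => /setU1P[->|/IH H].
  by rewrite !inE => /orP[]->; rewrite ?orbT.
by move=> /H; rewrite [u \in x :: _]inE => ->; rewrite orbT.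
Qed.

Lemma card_walk_edges_le x p : #|walk_edges x p| <= size p.
Proof.
elim: p x => [|y p IH] x; first by rewrite walk_edges_nil cards0.
by rewrite walk_edges_cons cardsU1 -[size _]/(1 + size p) leq_add ?leq_b1.
Qed.

Lemma card_walk_edges x p : uniq (x :: p) -> #|walk_edges x p| = size p.
Proof.
elim: p x => [|y p IH] x; first by rewrite walk_edges_nil cards0.
move=> /= /andP[xp yp]; rewrite walk_edges_cons cardsU1 IH//.
rewrite (_ : _ \notin _)//; apply: contra xp => /sub_walk_edges; apply.
by rewrite !inE eqxx.
Qed.

Lemma uniq_path_neq x p : uniq (x :: p) -> path (fun u v => u != v) x p.
Proof.
elim: p x => [//|y p IH] x /= /andP[]; rewrite inE negb_or => /andP[-> _].
exact: IH.
Qed.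

Lemma edge_card G e : e \in edges G -> #|e| = 2.
Proof. by move=> eG; have /forall_inP/(_ _ eG)/andP[/eqP] := graph_wf G. Qed.

Lemma edge_sub G e : e \in edges G -> e \subset vertices G.
Proof. by move=> eG; have /forall_inP/(_ _ eG)/andP[] := graph_wf G. Qed.

Lemma adj_neq G u v : adj (edges G) u v -> u != v.
Proof. by rewrite /adj => /edge_card/eqP; rewrite cards2; case: (u != v). Qed.

Lemma adj_vertex G u v : adj (edges G) u v -> v \in vertices G.
Proof. by move=> /edge_sub /subsetP; apply; rewrite !inE eqxx orbT. Qed.

Lemma wf_walk (V : {set T}) x p : path (fun u v => u != v) x p ->
  {subset x :: p <= V} -> wf_graph (V, walk_edges x p).
Proof.
move=> xp pV; apply/forall_inP => e /= ep; apply/andP; split; last first.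
  by apply/subsetP => u /(sub_walk_edges ep) /pV.
elim: p x xp ep {pV} => [|y p IH] x /=; first by rewrite walk_edges_nil inE.
move=> /andP[xy yp]; rewrite walk_edges_cons => /setU1P[->|].
  by rewrite cards2 xy.
exact: IH.
Qed.

Lemma edges_complete G : edges G \subset edges (complete_graph T).
Proof. by apply/subsetP => e /edge_card/eqP eG; rewrite inE. Qed.

Lemma path_vertices G x p : x \in vertices G -> path (adj (edges G)) x p ->
  {subset x :: p <= vertices G}.
Proof.
elim: p x => [|y p IH] x xG /=; first by move=> _ z; rewrite inE => /eqP->.
move=> /andP[xy yp] z; rewrite inE => /predU1P[->//|].
exact: (IH y (adj_vertex xy)).
Qed.

Lemma connect_is_path_between G x y :
  x \in vertices G -> connect (adj (edges G)) x y ->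
  exists2 Q : graph T, subgraph Q G & is_path_between x y Q.
Proof.
move=> xG /connectP[p0 /shortenP[p xp up _] ->].
have wf : wf_graph ([set:: x :: p], walk_edges x p).
  apply: wf_walk; last by move=> z zp; rewrite inE.
  by apply: sub_path xp => u v; exact: adj_neq.
exists (Graph wf); last by exists p.
rewrite /subgraph /vertices /edges /= -walk_edges_path xp andbT.
by apply/subsetP => z; rewrite inE; exact: (path_vertices xG xp).
Qed.

(** Rotating the cycle to start at v makes the second and the last vertex its neighbours; they
    differ because there are at least three vertices. *)
Lemma cycle_two_neighbours C v : is_cycle C -> v \in vertices C ->
  exists u w, [/\ u != w, adj (edges C) v u & adj (edges C) v w].
Proof.
move=> [x [p [sz un -> ->]]]; rewrite inE => vp.
have : cycle (adj (walk_edges x (rcons p x))) (x :: p) by exact: path_walk_edges.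
move: (walk_edges _ _) => E.
have [i q Eq] := rot_to vp.
rewrite -(rot_cycle i) Eq; move: sz un; rewrite -(size_rot i) -(rot_uniq i) Eq.
case: q {Eq} => [//|a [//|b q]] _ /=; rewrite rcons_path.
move=> /and4P[_ ab _ _] /and4P[va _ _ lv]; exists a, (last b q); split => //.
  by apply: contraNneq ab => ->; exact: mem_last.
by rewrite adj_sym.
Qed.

Lemma adj_walk_index x p u v : uniq (x :: p) -> adj (walk_edges x p) u v ->
  index v (x :: p) = (index u (x :: p)).+1 \/
  index u (x :: p) = (index v (x :: p)).+1.
Proof.
elim: p x => [|y p IH] x; first by rewrite /adj walk_edges_nil inE.
move=> /= /andP[xyp yp]; rewrite /adj walk_edges_cons => /setU1P[e|uv].
  have xy : x != y by apply: contraNneq xyp => ->; rewrite mem_head.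
  have : u \in [set x; y] by rewrite -e !inE eqxx.
  have : v \in [set x; y] by rewrite -e !inE eqxx orbT.
  have : x \in [set u; v] by rewrite e !inE eqxx.
  have : y \in [set u; v] by rewrite e !inE eqxx orbT.
  rewrite !inE => yuv xuv /orP[]/eqP vE /orP[]/eqP uE; move: yuv xuv;
    rewrite vE uE.
  - by rewrite orbb eq_sym (negPf xy).
  - by rewrite !eqxx (negPf xy); right.
  - by rewrite !eqxx (negPf xy); left.
  - by rewrite orbb (negPf xy).
have neq w : w \in [set u; v] -> x == w = false.
  move=> w_uv; apply/negbTE; apply: contraNneq xyp => ->.
  exact: sub_walk_edges uv w_uv.
rewrite !neq ?inE ?eqxx ?orbT//.
by have [/= ->|/= ->] := IH y yp uv; [left|right].
Qed.

Lemma is_tree_walk G x p : uniq (x :: p) -> vertices G = [set:: x :: p] ->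
  edges G = walk_edges x p -> is_tree G.
Proof.
move=> up VG EG; split.
- by apply/card_gt0P; exists x; rewrite VG inE mem_head.
- move=> u v uG vG; apply: connect_is_path_between => //.
  have con z : z \in vertices G -> connect (adj (edges G)) x z.
    by rewrite VG EG inE => zp; exact: (path_connect (path_walk_edges x p)).
  apply: connect_trans (con v vG).
  by rewrite (sym_connect_sym (@adj_sym _)) con.
- move=> C CG Cc.
  (* On the cycle, take the vertex v of least index along the walk. Both of its neighbours would
     have to be the immediate successor of v. *)
  have [v0 v0C] : exists v, v \in vertices C.
    by have [y [q [_ _ -> _]]] := Cc; exists y; rewrite inE mem_head.
  case: (arg_minnP (fun v => index v (x :: p)) v0C) => v vC vmin.
  have [u [w [uw vu vw]]] := cycle_two_neighbours Cc vC.
  have nb z : adj (edges C) v z ->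
      index z (x :: p) = (index v (x :: p)).+1 /\ z \in x :: p.
    move=> vz; have zC := vmin _ (adj_vertex vz).
    have vzp : adj (walk_edges x p) v z.
      by rewrite -EG; case/andP: CG => _ /subsetP; apply.
    split; last by apply: (sub_walk_edges vzp); rewrite !inE eqxx orbT.
    by case: (adj_walk_index up vzp) => // e; move: zC; rewrite e ltnn.
  have [iu up'] := nb _ vu; have [iw wp] := nb _ vw.
  by move: uw; rewrite -(nth_index x up') -(nth_index x wp) iu iw eqxx.
Qed.

(** Induction by deleting a leaf. A leaf is found at the end x of a longest path: another neighbour
    of x would either prolong the path or close a cycle. The bound by the number of vertices already
    puts trees among the sparse edge sets of the union bound. *)
Lemma acyclic_card_edges G : (forall C, subgraph C G -> ~ is_cycle C) ->
  #|edges G| <= #|vertices G|.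
Proof.
have [n] := ubnP #|vertices G|; elim: n G => // n IH G; rewrite ltnS => VGn acG.
have [->|/set0Pn [e eG]] := eqVneq (edges G) set0; first by rewrite cards0.
(* [P k]: there is a simple path with k edges. *)
pose P k := [exists x : T, exists p : k.-tuple T,
  uniq (x :: p) && path (adj (edges G)) x p].
have P1 : P 1.
  have /eqP/cards2P [a [b [ab E]]] := edge_card eG.
  apply/existsP; exists a; apply/existsP; exists [tuple b].
  by rewrite /= inE ab /adj -E eG.
have Pb k : P k -> k <= #|T|.
  case/existsP => x /existsP[p /andP[/card_uniqP E _]].
  by have := max_card [in x :: p]; rewrite E /= size_tuple => /ltnW.
have [k Pk kmax] := ex_maxnP (ex_intro _ 1 P1) Pb.
case/existsP: Pk => x /existsP[p /andP[up xp]].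
have : 0 < size p by rewrite size_tuple kmax.
case: p up xp => -[//|y p] /= /eqP sp up /andP[xy yp] _.
have deg z : adj (edges G) x z -> z = y.
  move=> xz; apply/eqP; apply: contraT => zy.
  have zx : z != x by rewrite eq_sym (adj_neq xz).
  have [zp|zp] := boolP (z \in p); last first.
    suff /kmax : P k.+1 by rewrite ltnn.
    apply/existsP; exists z; apply/existsP.
    have sz : size (x :: y :: p) == k.+1 by rewrite /= sp.
    exists (Tuple sz) => /=; rewrite !inE !negb_or zx zy zp adj_sym xz xy yp.
    by move: up; rewrite !inE negb_or => /and3P[/andP[-> ->] -> ->].
  (* The neighbour z lies on the path, so the segment from x to z together with the edge from z back
     to x is a cycle. *)
  case/splitPr: zp up yp zy zx => p1 p2 up yp zy zx.
  have up' : uniq (x :: rcons (y :: p1) z).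
    have : uniq ((x :: rcons (y :: p1) z) ++ p2) by rewrite /= cat_rcons.
    by rewrite cat_uniq => /andP[].
  have cp : path (adj (edges G)) x (rcons (rcons (y :: p1) z) x).
    rewrite rcons_path last_rcons adj_sym xz andbT /= xy /=.
    by move: yp; rewrite cat_path /= rcons_path => /and3P[-> ->].
  have xG : x \in vertices G by rewrite adj_sym in xy; exact: adj_vertex xy.
  have wf : wf_graph ([set:: x :: rcons (y :: p1) z],
                     walk_edges x (rcons (rcons (y :: p1) z) x)).
    apply: wf_walk; first by apply: sub_path cp => a b; exact: adj_neq.
    move=> a; rewrite in_cons mem_rcons in_cons orbA orbb => h.
    by rewrite inE in_cons.
  case: (acG (Graph wf)); last first.
    exists x, (rcons (y :: p1) z); split => //=.
    by rewrite size_rcons.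
  rewrite /subgraph /vertices /edges /= -walk_edges_path cp andbT.
  apply/subsetP => a; rewrite inE => ha; apply: (path_vertices xG cp).
  by rewrite inE mem_rcons inE; move: ha; rewrite inE => /orP[->|->];
     rewrite ?orbT.
have xG : x \in vertices G by rewrite adj_sym in xy; exact: adj_vertex xy.
have wf : wf_graph (vertices G :\ x, edges G :\ [set x; y]).
  apply/forall_inP => f /=; rewrite !inE => /andP[fxy fG].
  rewrite (edge_card fG) eqxx /=; apply/subsetP => z zf.
  rewrite !inE (subsetP (edge_sub fG) _ zf) andbT; apply: contraNneq fxy => zx.
  have /eqP/cards2P [a [b [ab E]]] := edge_card fG.
  rewrite E; move: zf; rewrite E zx !inE => /orP[]/eqP xE; move: fG; rewrite E.
    by rewrite -xE => /deg ->.
  by rewrite -xE -/(adj _ a x) adj_sym => /deg ->; rewrite setUC.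
have := IH (Graph wf); rewrite /vertices /edges /=.
have := cardsD1 x (vertices G); rewrite xG /vertices => cV.
have := cardsD1 [set x; y] (edges G); rewrite -/(adj _ x y) xy /edges => cE.
rewrite cV cE !add1n ltnS; apply.
  by move: VGn; rewrite /vertices cV add1n.
move=> C /andP[CV CE]; apply: acG; apply/andP; split.
  exact: subset_trans CV (subD1set _ _).
exact: subset_trans CE (subD1set _ _).
Qed.

Lemma cycle_graph x p : uniq (x :: p) -> 3 <= size (x :: p) ->
  exists C, [/\ is_cycle C, vertices C = [set:: x :: p]
    & edges C = [set last x p; x] |: walk_edges x p].
Proof.
move=> up sp.
have wf : wf_graph ([set:: x :: p], walk_edges x (rcons p x)).
  apply: wf_walk; last first.
    by move=> z; rewrite inE !inE mem_rcons inE; case: (z == x).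
  rewrite rcons_path (uniq_path_neq up).
  case: p up sp => [//|y p] /= /andP[xp _] _.
  by apply: contraNneq xp => <-; exact: mem_last.
exists (Graph wf); split => //; first by exists x, p.
by rewrite /edges /= walk_edges_rcons.
Qed.

Lemma path_graph x p : uniq (x :: p) ->
  exists G, vertices G = [set:: x :: p] /\ edges G = walk_edges x p.
Proof.
move=> up; have wf : wf_graph ([set:: x :: p], walk_edges x p).
  by apply: wf_walk; [exact: uniq_path_neq|move=> z zp; rewrite inE].
by exists (Graph wf).
Qed.

Lemma card_edges_path x y G : is_path_between x y G -> #|edges G| <= #|T|.
Proof.
move=> [p [up _ _ ->]]; rewrite (leq_trans (card_walk_edges_le _ _))//.
by rewrite ltnW// -[(size p).+1]/(size (x :: p)) -(card_uniqP up) max_card.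
Qed.

Lemma card_edges_cycle G : is_cycle G -> #|edges G| <= #|T|.
Proof.
move=> [x [p [_ up _ ->]]]; rewrite (leq_trans (card_walk_edges_le _ _))//.
by rewrite size_rcons -[(size p).+1]/(size (x :: p)) -(card_uniqP up) max_card.
Qed.

Lemma card_edges_tree G : is_tree G -> #|edges G| <= #|T|.
Proof.
by move=> [_ _ /acyclic_card_edges h]; apply: leq_trans h (max_card _).
Qed.

End Walks.

Lemma walk_edges_cat (T : finType) (x : T) p q :
  walk_edges x (p ++ q) = walk_edges x p :|: walk_edges (last x p) q.
Proof.
elim: p x => [|y p IH] x /=; first by rewrite walk_edges_nil set0U.
by rewrite !walk_edges_cons IH setUA.
Qed.

Lemma path_walk_edgesP (T : finType) (r : rel T) x p e : path r x p ->
  e \in walk_edges x p -> exists u v, e = [set u; v] /\ r u v.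
Proof.
elim: p x => [|y p IH] x /=; first by rewrite walk_edges_nil inE.
move=> /andP[xy yp]; rewrite walk_edges_cons => /setU1P[->|]; last exact: IH.
by exists x, y.
Qed.

(** The search runs on the complement A of the two endpoints, which are prescribed because of the
    paths from vertex 1 to vertex 2. Its path is placed right after [v0], then come the leftover
    vertices and [v1]. E consists of the edges inside the search path; the 3 accounts for the two
    endpoints and for a path having one edge fewer than vertices. *)
Lemma hamilton_path_heavy (T : finType) (r : rel T) (m : nat) (v0 v1 : T) :
  v0 != v1 -> symmetric r ->
  (forall S U : {set T}, S :&: U = set0 -> #|S| = m -> #|U| = m ->
     exists u v, [/\ u \in S, v \in U & r u v]) ->
  exists s, [/\ uniq (v0 :: s), last v0 s = v1, [set:: v0 :: s] = [set: T] &
    exists E : {set {set T}}, [/\ E \subset walk_edges v0 s,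
      #|T| <= #|E| + (m.*2 + 3)
      & forall e, e \in E -> exists u v, e = [set u; v] /\ r u v]].
Proof.
move=> v01 r_sym hr; pose A := ~: [set v0; v1].
have [S U _ _|p [up pA sp cA]] := @sorted_dfs T r A m r_sym.
  by rewrite -setI_eq0 => /eqP; exact: hr.
have cT : #|T| = (#|A| + 2)%N.
  by rewrite -(cardsC [set v0; v1]) cards2 v01 addnC.
pose q := enum (A :\: [set:: p]).
have qE z : (z \in q) = (z \notin p) && (z \in A).
  by rewrite mem_enum in_setD inE.
have AE z : (z \in A) = (z != v0) && (z != v1) by rewrite !inE negb_or.
have up' : uniq (v0 :: rcons (p ++ q) v1).
  rewrite /= mem_rcons inE negb_or v01 mem_cat negb_or qE AE eqxx /= andbF andbT.
  have -> /= : v0 \notin p by apply/negP => /pA; rewrite AE eqxx.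
  rewrite rcons_uniq mem_cat negb_or qE AE eqxx /= !andbF andbT.
  have -> /= : v1 \notin p by apply/negP => /pA; rewrite AE eqxx andbF.
  rewrite cat_uniq up enum_uniq andbT /=; apply/hasPn => z.
  by rewrite qE => /andP[].
exists (rcons (p ++ q) v1); split => //; first by rewrite last_rcons.
  apply/setP => z; rewrite !inE mem_rcons inE mem_cat qE AE.
  by case: (z == v0); case: (z == v1); case: (z \in p).
case: p up pA sp cA q qE up' => [|y p] up pA sp cA q qE up'.
  exists set0; split; first by rewrite sub0set.
    by rewrite cT; move: cA => /=; lia.
  by move=> e; rewrite inE.
exists (walk_edges y p); split.
- rewrite rcons_cat /= walk_edges_cons walk_edges_cat.
  by apply: subset_trans (subsetUr _ _); exact: subsetUl.
- by rewrite card_walk_edges// cT; move: cA => /=; lia.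
- by move=> e; apply: path_walk_edgesP; exact: sp.
Qed.

From mathcomp Require Import all_classical all_reals all_analysis.
From mathcomp Require Import measurable_realfun.
Import numFieldNormedType.Exports.

Local Open Scope classical_set_scope.
Local Open Scope ring_scope.

(** * Independence and Chernoff bounds *)

Import HBNNSimple.

Lemma measurable_ge d (T : measurableType d) (R : realType) (S : T -> R) (c : R) :
  measurable_fun setT S ->
  measurable [set w | c <= S w].
Proof.
move=> mS; have := mS measurableT `[c, +oo[%classic (measurable_itv _).
rewrite setTI; congr measurable; apply/seteqP.
by split => w /=; rewrite in_itv/= andbT.
Qed.

Lemma measurable_gt d (T : measurableType d) (R : realType) (S : T -> R) (c : R) :
  measurable_fun setT S ->
  measurable [set w | c < S w].
Proof.
move=> mS; have := mS measurableT `]c, +oo[%classic (measurable_itv _).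
rewrite setTI; congr measurable; apply/seteqP.
by split => w /=; rewrite in_itv/= andbT.
Qed.

Section Independence.
Context d (T : measurableType d) (R : realType) (P : probability T R).

Lemma integral_nnsfun_mul (Y : {RV P >-> R}) (Z : T -> R)
    (phi : {nnsfun R >-> R}) :
  measurable_fun setT Z -> (forall w, 0 <= Z w) ->
  (\int[P]_w ((phi (Y w))%:E * (Z w)%:E) =
   \sum_(r \in range phi)
     r%:E * \int[P]_w ((\1_(phi @^-1` [set r]) (Y w))%:E * (Z w)%:E))%E.
Proof.
move=> mZ Z0; have mZE : measurable_fun setT (EFin \o Z) by exact/measurable_EFinP.
have mphi r : measurable (phi @^-1` [set r]).
  rewrite -[X in measurable X]setTI; exact: measurable_funP.
have mI r : measurable_fun setT
    (fun w => (\1_(phi @^-1` [set r]) (Y w))%:E * (Z w)%:E)%E.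
  apply: emeasurable_funM => //; apply/measurable_EFinP.
  by apply: measurableT_comp => //; exact: measurable_indic.
under eq_integral => w _.
  rewrite fimfunE -fsumEFin; last exact: fimfunP.
  rewrite ge0_mule_fsuml; last by move=> r; rewrite EFinM nnfun_muleindic_ge0.
  over.
rewrite ge0_integral_fsum//; last 2 first.
- move=> r; under eq_fun => w do rewrite EFinM -muleA.
  exact: measurable_funeM.
- move=> r w _; rewrite mule_ge0 ?lee_fin// -lee_fin EFinM.
  exact: nnfun_muleindic_ge0.
- apply: eq_fsbigr => r; rewrite inE => -[x _ <-].
  under eq_integral do rewrite EFinM -muleA.
  rewrite ge0_integralZl// ?lee_fin// => w _.
  by rewrite mule_ge0// lee_fin.
Qed.

(** The passage from indicators to nonnegative f through simple functions and monotone convergence.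
    Z stays abstract so that it can hold the remaining factors of a product. *)
Lemma integral_indep_mul (Y : {RV P >-> R}) (Z : T -> R) (c : R)
    (f : R -> R) :
  measurable_fun setT Z -> (forall w, 0 <= Z w) -> 0 <= c ->
  measurable_fun setT f -> (forall x, 0 <= f x) ->
  (forall B, measurable B ->
     \int[P]_w ((\1_B (Y w))%:E * (Z w)%:E) = P (Y @^-1` B) * c%:E)%E ->
  (\int[P]_w ((f (Y w))%:E * (Z w)%:E) = \int[P]_w (f (Y w))%:E * c%:E)%E.
Proof.
move=> mZ Z0 c0 mf f0 H.
have mfE : measurable_fun (setT : set R) (EFin \o f).
  exact/measurable_EFinP.
pose phi := nnsfun_approx (@measurableT _ R) mfE.
have f0E (x : R) : setT x -> (0 <= (EFin \o f) x)%E.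
  by rewrite lee_fin.
have phi_f w : (phi n (Y w))%:E @[n --> \oo] --> (f (Y w))%:E.
  exact: (@cvg_nnsfun_approx _ _ _ _ measurableT _ mfE f0E (Y w)).
have phi_nd w m n : (m <= n)%N -> phi m (Y w) <= phi n (Y w).
  by move=> mn; exact/lefP/nd_nnsfun_approx.
have mphi n : measurable_fun setT (fun w => (phi n (Y w))%:E).
  by apply/measurable_EFinP; exact: measurableT_comp.
have key (Z' : T -> R) : measurable_fun setT Z' ->
    (forall w, 0 <= Z' w) ->
    (\int[P]_w ((phi n (Y w))%:E * (Z' w)%:E))%E @[n --> \oo] -->
    (\int[P]_w ((f (Y w))%:E * (Z' w)%:E))%E.
  move=> mZ' Z'0.
  pose g n w := ((phi n (Y w))%:E * (Z' w)%:E)%E.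
  have -> : (\int[P]_w ((f (Y w))%:E * (Z' w)%:E) =
      \int[P]_w limn (g ^~ w))%E.
    apply: eq_integral => w _; apply/esym/cvg_lim => //.
    by apply: cvgeZr => //; exact: phi_f.
  have mZE : measurable_fun setT (EFin \o Z') by exact/measurable_EFinP.
  apply: cvg_monotone_convergence => //.
  - by move=> n; exact: emeasurable_funM.
  - by move=> n w _; rewrite mule_ge0// lee_fin.
  - by move=> w _ m n mn; rewrite lee_wpmul2r// lee_fin ?phi_nd// Z'0.
(* Both sides are limits along the same simple functions: [key] is used for Z, and for the constant
   1 multiplied by c. *)
apply: (@cvg_unique _ _ _ _ _ _ (key Z mZ Z0)) => //.
have := key (cst 1) (measurable_cst _) (fun=> ler01).
under [X in _ --> X -> _]eq_integral do rewrite mule1.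
move=> /(@cvgeZr _ _ _ _ _ c%:E isT).
apply: cvg_trans; apply: near_eq_cvg; apply: nearW => n.
rewrite !integral_nnsfun_mul//.
have indP B : measurable B ->
    (\int[P]_w ((\1_B (Y w))%:E * (cst 1 w)%:E) = P (Y @^-1` B))%E.
  move=> mB; under eq_integral do rewrite mule1.
  have mYB : measurable (Y @^-1` B).
    by rewrite -[X in measurable X]setTI; exact: measurable_funP.
  by rewrite -[in RHS](setIT (Y @^-1` B)) -integral_indic.
have mr r : measurable (phi n @^-1` [set r]).
  by rewrite -[X in measurable X]setTI; exact: measurable_funP.
rewrite ge0_mule_fsuml; last first.
  move=> r; rewrite indP//; have [r0|r0] := leP 0 r; first by rewrite mule_ge0.
  rewrite (_ : Y @^-1` _ = set0) ?measure0 ?mule0//.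
  apply/seteqP; split => // w /= E; move: r0; rewrite -E ltNge.
  by rewrite (@fun_ge0 _ _ (phi n)).
by apply: eq_fsbigr => r _; rewrite -muleA indP// H.
Qed.

Lemma measurable_all_in (I : finType) (G : {set I}) (Y : I -> {RV P >-> R})
    (B : I -> set R) : (forall i, measurable (B i)) ->
  measurable [set w | forall i, i \in G -> B i (Y i w)].
Proof.
move=> mB; rewrite (_ : mkset _ = \bigcap_(i in [set` G]) (Y i @^-1` B i))//.
apply: fin_bigcap_measurable; first exact: finite_finset.
by move=> i _; rewrite -[X in measurable X]setTI; exact: measurable_funP.
Qed.

(** The events on G are there for the induction on F: to split off the factor of i, one tests it
    against indicators, and each test moves i from F to G. Independence is then invoked only for
    events. *)
Lemma integral_prod_indep (I : finType) (J F G : {set I})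
    (Y : I -> {RV P >-> R}) (f : R -> R) (M : R) (B : I -> set R) :
  independent P J (fun i => Y i : T -> R) ->
  measurable_fun setT f -> (forall x, 0 <= f x) ->
  (forall i, i \in J -> \int[P]_w (f (Y i w))%:E = M%:E)%E ->
  F \subset J -> G \subset J -> {in F, forall i, i \notin G} ->
  (forall i, measurable (B i)) ->
  (\int[P]_w ((\prod_(i in F) f (Y i w)) *
     \1_[set w | forall i, i \in G -> B i (Y i w)] w)%:E =
   (M ^+ #|F|)%:E * P [set w | forall i, i \in G -> B i (Y i w)])%E.
Proof.
move=> ind mf f0 fM; have [n] := ubnP #|F|.
elim: n F G B => // n IH F G B; rewrite ltnS => Fn FJ GJ FG mB.
have mE := measurable_all_in G Y mB.
have [->|/finset.set0Pn[i iF]] := eqVneq F finset.set0.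
  under eq_integral do rewrite big_set0 mul1r.
  by rewrite integral_indic// setIT cards0 expr0 mul1e.
have iJ : i \in J by exact: (fintype.subsetP FJ).
have iG := FG i iF.
have ji j : j \in G -> (j == i) = false.
  by move=> jG; apply/negbTE; apply: contraNneq iG => <-.
set E := [set w | _] in mE *.
pose Z w := (\prod_(j in (F :\ i)%SET) f (Y j w)) * \1_E w.
have cF : #|F| = #|(F :\ i)%SET|.+1 by rewrite (finset.cardsD1 i F) iF.
have mfY j : measurable_fun setT (fun w => f (Y j w)).
  exact: measurableT_comp.
have prod0 w (A : {set I}) : 0 <= \prod_(j in A) f (Y j w) by exact: prodr_ge0.
have PE : P E \is a fin_num by exact: fin_num_measure.
have M0 : 0 <= M.
  rewrite -lee_fin -(fM _ iJ); apply: integral_ge0 => w _.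
  by rewrite lee_fin.
have mZ : measurable_fun setT Z.
  apply: measurable_funM; last exact: measurable_indic.
  by under eq_fun do rewrite -big_enum/=; exact: measurable_prod.
transitivity (\int[P]_w ((f (Y i w))%:E * (Z w)%:E))%E.
  by apply: eq_integral => w _; rewrite -EFinM mulrA -big_setD1.
rewrite (@integral_indep_mul _ _ (M ^+ #|(F :\ i)%SET| * fine (P E)))//.
- by rewrite fM// cF exprS !EFinM fineK// muleA.
- by move=> w; rewrite mulr_ge0// indicE ler0n.
- by rewrite mulr_ge0 ?exprn_ge0// fine_ge0.
move=> A mA; pose B' j := if j == i then A else B j.
have mB' j : measurable (B' j) by rewrite /B'; case: ifP.
transitivity (\int[P]_w ((\prod_(j in (F :\ i)%SET) f (Y j w)) *
     \1_[set w | forall j, j \in (i |: G)%SET -> B' j (Y j w)] w)%:E)%E.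
  apply: eq_integral => w _; rewrite -EFinM mulrCA; congr ((_ * _)%:E).
  rewrite !indicE -natrM mulnb; congr (_%:R); congr nat_of_bool.
  apply/andP/idP; rewrite !inE /E /=.
    move=> [/= Aw Ew] j /setU1P[->|jG]; first by rewrite /B' eqxx.
    by rewrite /B' ji//; exact: Ew.
  move=> H; split; first by have := H i (setU11 _ _); rewrite /B' eqxx.
  by move=> j jG; have := H j (setU1r _ jG); rewrite /B' ji.
rewrite IH//; last 4 first.
- by rewrite -ltnS -cF ltnS.
- by apply: fintype.subset_trans FJ; exact: finset.subD1set.
- by rewrite finset.subUset finset.sub1set iJ.
- move=> j; rewrite in_setD1 => /andP[nji jF].
  by rewrite in_setU1 negb_or nji FG.
rewrite [in RHS]EFinM fineK// muleCA; congr (_ * _)%E.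
rewrite !ind//; last by rewrite finset.subUset finset.sub1set iJ.
rewrite finset.big_setU1//= {1}/B' eqxx; congr (_ * _)%E.
by apply: eq_bigr => j jG; rewrite /B' ji.
Qed.

Lemma markov_expR (S : T -> R) (u c : R) : measurable_fun setT S -> 0 <= u ->
  (P [set w | c <= S w]%R <=
   \int[P]_w (expR (u * S w))%:E * (expR (- (u * c)))%:E)%E.
Proof.
move=> mS u0.
have mA := measurable_ge c mS.
have mexp : measurable_fun setT (fun w => (expR (u * S w))%:E).
  by apply/measurable_EFinP; apply: measurableT_comp => //;
     exact: measurable_funM.
rewrite expRN lee_pdivlMr ?expR_gt0// muleC -[X in (_ * P X)%E]setIT.
rewrite -integral_indic// -ge0_integralZl//; last first.
  by apply/measurable_EFinP; exact: measurable_indic.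
apply: ge0_le_integral => //.
- apply: measurable_funeM; apply/measurable_EFinP; exact: measurable_indic.
move=> w _; rewrite -EFinM lee_fin indicE.
case: (boolP (w \in _)) => [|_]; last by rewrite mulr0 expR_ge0.
by rewrite inE /= mulr1 ler_expR => cS; exact: ler_wpM2l.
Qed.

(** Since [1 <= M], the power N serves every F with at most N elements, hence graphs with different
    numbers of edges. *)
Lemma chernoff_indep_sum (I : finType) (J F : {set I}) (Y : I -> {RV P >-> R})
    (u M c : R) (N : nat) :
  independent P J (fun i => Y i : T -> R) -> 0 <= u -> 1 <= M ->
  (forall i, i \in J -> \int[P]_w (expR (u * Y i w))%:E = M%:E)%E ->
  F \subset J -> (#|F| <= N)%N ->
  (P [set w | c <= \sum_(i in F) Y i w]%R <= (M ^+ N * expR (- (u * c)))%:E)%E.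
Proof.
move=> ind u0 M1 YM FJ FN.
have mS : measurable_fun setT (fun w => \sum_(i in F) Y i w).
  by under eq_fun do rewrite -big_enum/=; exact: measurable_sum.
apply: le_trans (markov_expR _ mS u0) _.
have := @integral_prod_indep _ J F finset.set0 Y (fun x => expR (u * x)) M
  (fun=> setT) ind _ _ YM FJ.
rewrite (_ : [set w | _] = setT); last by apply/seteqP; split=> w //= _ i; rewrite inE.
rewrite probability_setT mule1 EFinM => H.
rewrite lee_pmul2r ?lte_fin ?expR_gt0//.
rewrite (_ : (\int[P]_w (expR (u * _))%:E)%E = (M ^+ #|F|)%:E).
  by rewrite lee_fin ler_weXn2l.
rewrite -H//.
- apply: eq_integral => w _; rewrite indicT mulr1 mulr_sumr.
  by rewrite (big_morph expR (@expRD R) (expR0 R)).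
- by apply: measurableT_comp => //; exact: measurable_funM.
- exact: finset.sub0set.
- by move=> i _; rewrite finset.in_set0.
Qed.

(** The strict event is the increasing union of the events at levels above c. This avoids the level
    c itself, where the rate may be too small. *)
Lemma probability_gt_le (S : T -> R) (c b : R) : measurable_fun setT S ->
  (forall c', c < c' -> (P [set w | c' <= S w]%R <= b%:E)%E) ->
  (P [set w | c < S w]%R <= b%:E)%E.
Proof.
move=> mS H.
pose A n := [set w | c + n.+1%:R^-1 <= S w].
have mA n : measurable (A n) by exact: measurable_ge.
have -> : [set w | c < S w] = \bigcup_n A n.
  apply/seteqP; split => w /=.
    move=> cS; have cS0 : 0 < S w - c by rewrite subr_gt0.
    have [n _ /(_ n (leqnn _))] := near_infty_natSinv_lt (PosNum cS0).
    by move=> /= h; exists n => //; rewrite /A /= -lerBrDl ltW.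
  by move=> [n _]; rewrite /A /=; apply: lt_le_trans; rewrite ltrDl invr_gt0.
have ndA : nondecreasing_seq A.
  apply/nondecreasing_seqP => n; apply/subsetPset => w; rewrite /A /=.
  by apply: le_trans; rewrite lerD2l lef_pV2 ?posrE// ler_nat.
have cv : (P \o A) n @[n --> \oo] --> P (\bigcup_n A n).
  exact: nondecreasing_cvg_mu mA (bigcup_measurable (fun n _ => mA n)) ndA.
rewrite -(cvg_lim _ cv)//; apply: lime_le; first exact: cvgP cv.
by apply: nearW => n; apply: H; rewrite ltrDl invr_gt0.
Qed.

End Independence.

Lemma same_law_integral d d' (T : measurableType d) (T' : measurableType d')
    (R : realType) (P : probability T R) (P' : probability T' R)
    (X : {RV P >-> R}) (Y : {RV P' >-> R}) (f : R -> R) :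
  same_law P X P' Y -> measurable_fun setT f -> (forall x, 0 <= f x) ->
  (\int[P]_w (f (X w))%:E = \int[P']_w (f (Y w))%:E)%E.
Proof.
move=> XY mf f0; have mfE : measurable_fun setT (EFin \o f).
  exact/measurable_EFinP.
transitivity (\int[pushforward P X]_x (f x)%:E)%E.
  by rewrite ge0_integral_pushforward// => x _; rewrite lee_fin.
transitivity (\int[pushforward P' Y]_x (f x)%:E)%E; last first.
  by rewrite ge0_integral_pushforward// => x _; rewrite lee_fin.
by apply: eq_measure_integral => A mA _; exact: XY.
Qed.

(** * The rate function and its inverse *)

Lemma measurable_expR_mul (R : realType) (t : R) :
  measurable_fun setT (fun x : R => expR (t * x)).
Proof. by apply: measurableT_comp => //; exact: measurable_funM. Qed.

Section Rate.
Context d (T : measurableType d) (R : realType) (P : probability T R).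
Variable X : {RV P >-> R}.
Hypothesis X_good : good P X.

Lemma mgfE t : ('M_P X t = \int[P]_w (expR (t * X w))%:E)%E.
Proof.
by rewrite /mmt_gen_fun unlock; apply: eq_integral => w _ /=; rewrite mulrC.
Qed.

Lemma measurable_mgf t : measurable_fun setT (fun w => (expR (t * X w))%:E).
Proof.
apply/measurable_EFinP.
exact: measurableT_comp (measurable_expR_mul t) (measurable_funP X).
Qed.

Lemma mgfN t : ('M_P X (- t) = 'M_P X t)%E.
Proof.
have [sym _ _] := X_good.
rewrite !mgfE; transitivity (\int[P]_w (expR (- t * (\- X) w))%:E)%E.
  apply: (same_law_integral (X := X) (Y := (\- X)%R) (f := fun x => expR (- t * x))).
  - exact: sym.
  - exact: measurable_expR_mul.
  - by move=> x; exact: expR_ge0.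
by apply: eq_integral => w _ /=; rewrite mulrNN.
Qed.

Lemma mgf_abs t : ('M_P X `|t| = 'M_P X t)%E.
Proof. by have [t0|t0] := ger0P t; rewrite // mgfN. Qed.

(** By symmetry twice the moment is the mean of [y + 1 / y] with [y = expR (t * X)], and
    [y + 1 / y >= 2]. *)
Lemma mgf_ge1 t : (1 <= 'M_P X t)%E.
Proof.
have H : (2%:E <= 'M_P X t + 'M_P X t)%E.
  rewrite -[X in (_ <= _ + X)%E]mgfN !mgfE -ge0_integralD//; try exact: measurable_mgf.
  rewrite -[leLHS]mule1 -(probability_setT P) -integral_cst//.
  apply: ge0_le_integral => //.
  - by move=> w _; rewrite lee_fin.
  - by apply: emeasurable_funD; exact: measurable_mgf.
  - move=> w _; rewrite -EFinD lee_fin mulNr expRN.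
    have y0 := expR_gt0 (t * X w); set y := expR _ in y0 *.
    have : 0 <= (y - 1) ^+ 2 / y by rewrite divr_ge0 ?sqr_ge0// ltW.
    suff -> : (y - 1) ^+ 2 / y = y + y^-1 - 2 by rewrite subr_ge0.
    by field; rewrite gt_eqF.
have M0 : (0 <= 'M_P X t)%E.
  by rewrite mgfE integral_ge0// => w _; rewrite lee_fin expR_ge0.
move: M0 H; case: ('M_P X t)%E => [r _| _ _|]//; last by rewrite leey.
by rewrite -EFinD !lee_fin => ?; lra.
Qed.

Lemma log_mgf_ge0 t : (0 <= log_mgf P X t)%E.
Proof. by rewrite /log_mgf lne_ge0 mgf_ge1. Qed.

Lemma log_mgf0 : log_mgf P X 0 = 0%E.
Proof.
rewrite /log_mgf mgfE; under eq_integral do rewrite mul0r expR0.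
by rewrite integral_cst//= mul1e probability_setT lne1.
Qed.

Lemma rate_ub v s : ((v * s)%:E - log_mgf P X v <= rate P X s)%E.
Proof. by apply: ereal_sup_ubound; exists v. Qed.

Lemma rate_ge0 s : (0 <= rate P X s)%E.
Proof. by have := rate_ub 0 s; rewrite mul0r log_mgf0 sube0. Qed.

(** Strictness yields an actual parameter v beating L in the supremum. Symmetry allows replacing v
    by its absolute value, so that Markov's inequality applies to the upper tail. *)
Lemma rate_mgf_witness s L : 0 <= s -> (L%:E < rate P X s)%E ->
  exists u M, [/\ 0 <= u, 1 <= M,
    (\int[P]_w (expR (u * X w))%:E = M%:E)%E & M * expR (- (u * s)) <= expR (- L)].
Proof.
move=> s0 /ereal_sup_gt[_ [v _ <-]] Lv.
have : ('M_P X v = +oo)%E \/ exists2 M : R, 1 <= M & 'M_P X v = M%:E.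
  have := mgf_ge1 v; case: ('M_P X v)%E => [M| |] //; last by left.
  by rewrite lee_fin; right; exists M.
move=> [Moo|[M M1 ME]]; first by move: Lv; rewrite /log_mgf Moo /=.
exists `|v|, M; split => //; first by rewrite -mgfE mgf_abs.
have M0 : 0 < M by exact: lt_le_trans M1.
move: Lv; rewrite /log_mgf ME lne_EFin// -EFinB lte_fin => Lv.
rewrite -[X in X * _](lnK (x := M)) ?posrE// -expRD ler_expR.
have : v * s <= `|v| * s by rewrite ler_wpM2r// ler_norm.
lra.
Qed.

(** This is the form in which convexity and vanishing at 0 are used. It holds term by term in the
    supremum, because [log_mgf] is nonnegative. *)
Lemma rate_scale k s : 1 <= k -> (k%:E * rate P X s <= rate P X (k * s))%E.
Proof.
move=> k1; have k0 : 0 < k by exact: lt_le_trans k1.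
rewrite muleC -lee_pdivlMr//; apply: ge_ereal_sup => _ [v _ <-].
rewrite lee_pdivlMr//; apply: le_trans (rate_ub v _).
have := log_mgf_ge0 v; case: (log_mgf P X v) => [m| |]//; last first.
  by rewrite addeNy// mulNyr gtr0_sg// mul1e leNye.
rewrite !lee_fin => m0.
have : m <= m * k by rewrite ler_peMr.
lra.
Qed.

Lemma rate_scale_le k s L : 1 <= k -> (L%:E <= rate P X s)%E ->
  ((k * L)%:E <= rate P X (k * s))%E.
Proof.
move=> k1 H; apply: le_trans (rate_scale _ k1); rewrite EFinM lee_pmul2l//.
by rewrite lte_fin (lt_le_trans ltr01).
Qed.

Lemma rate_le s s' : 0 <= s -> s <= s' -> (rate P X s <= rate P X s')%E.
Proof.
move=> s0 ss'; apply: ge_ereal_sup => _ [v _ <-].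
apply: le_trans (rate_ub `|v| _); rewrite /log_mgf mgf_abs.
apply: leeD2r; rewrite lee_fin; apply: (@le_trans _ _ (`|v| * s)).
  by rewrite ler_wpM2r// ler_norm.
by rewrite ler_wpM2l.
Qed.

(** A finite exponential moment at [del / 2] bounds the rate below by an affine function of slope
    [del / 2]. *)
Lemma rate_unbounded L : exists2 s, 0 <= s & (L%:E <= rate P X s)%E.
Proof.
have [_ [del del0 /(_ (del / 2))H] _] := X_good.
have /H : `|del / 2| < del by rewrite gtr0_norm ?divr_gt0//; lra.
have := log_mgf_ge0 (del / 2); have := rate_ub (del / 2).
case: (log_mgf P X (del / 2)) => [m| |]// rub; rewrite lee_fin => m0 _.
exists ((`|L| + m) / (del / 2)).
  by rewrite divr_ge0 ?addr_ge0// ltW// divr_gt0.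
apply: le_trans (rub _); rewrite -EFinB lee_fin mulrC divfK ?gt_eqF ?divr_gt0//.
by rewrite addrK ler_norm.
Qed.

Definition rinv L : R := fine (rate_inv P X L).

Lemma rate_invE L : rate_inv P X L = (rinv L)%:E.
Proof.
rewrite /rinv fineK//; have [s s0 Ls] := rate_unbounded L.
rewrite ge0_fin_numE; last by apply: le_ereal_inf_tmp => _ [x [x0 _] <-].
by apply: (le_lt_trans _ (ltry s)); apply: ereal_inf_lbound; exists s.
Qed.

Lemma rinv_ge0 L : 0 <= rinv L.
Proof.
rewrite -lee_fin -rate_invE.
by apply: le_ereal_inf_tmp => _ [x [x0 _] <-].
Qed.

Lemma rinv_le L s : 0 <= s -> (L%:E <= rate P X s)%E -> rinv L <= s.
Proof.
by move=> s0 Ls; rewrite -lee_fin -rate_invE; apply: ereal_inf_lbound; exists s.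
Qed.

(** Strictness matters: for a uniform sign, [rinv L = 1] for every L above log 2, while the rate at
    1 is log 2. *)
Lemma rate_gt_rinv L s : rinv L < s -> (L%:E <= rate P X s)%E.
Proof.
rewrite -lte_fin -rate_invE => /ereal_inf_lt[_ [x [x0 Lx] <-]].
by rewrite lte_fin => xs; apply: le_trans Lx (rate_le x0 (ltW xs)).
Qed.

Lemma rate_lt_rinv L s : 0 <= s -> s < rinv L -> (rate P X s < L%:E)%E.
Proof.
by move=> s0 sL; rewrite ltNge; apply/negP => /(rinv_le s0); rewrite leNgt sL.
Qed.

Lemma rinv_scale k L : 1 <= k -> rinv (k * L) <= k * rinv L.
Proof.
move=> k1; have k0 : 0 < k by exact: lt_le_trans k1.
(* The share [e / k] moves the point strictly beyond [rinv L] before it is scaled by k. *)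
apply/ler_addgt0Pr => e e0; rewrite -[e](divfK (lt0r_neq0 k0)) [e / k * k]mulrC.
rewrite -mulrDr; apply: rinv_le.
  by rewrite mulr_ge0 ?addr_ge0 ?rinv_ge0// ltW// divr_gt0.
apply: rate_scale_le => //; apply: rate_gt_rinv.
by rewrite ltrDl divr_gt0.
Qed.

Lemma tail_le s L : 0 <= s -> (L%:E < rate P X s)%E ->
  (P [set w | s <= X w]%R <= (expR (- L))%:E)%E.
Proof.
move=> s0 /(rate_mgf_witness s0)[u [M [u0 M1 ME H]]].
apply: le_trans (markov_expR P s (measurable_funP X) u0) _.
by rewrite ME -EFinM lee_fin.
Qed.

Lemma chernoff_sum d' (T' : measurableType d') (P' : probability T' R)
    (I : finType) (J F : {set I}) (Y : I -> {RV P' >-> R}) (N : nat) L :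
  independent P' J (fun i => Y i : T' -> R) ->
  (forall i, i \in J -> same_law P' (Y i) P X) ->
  F \subset J -> (#|F| <= N)%N -> (0 < N)%N ->
  (P' [set w | N%:R * rinv L < \sum_(i in F) Y i w]%R
     <= (expR (- (N%:R * L)))%:E)%E.
Proof.
move=> ind law FJ FN N0; have N0R : 0 < N%:R :> R by rewrite ltr0n.
have mS : measurable_fun setT (fun w => \sum_(i in F) Y i w).
  by under eq_fun do rewrite -big_enum/=; exact: measurable_sum.
apply: probability_gt_le => //.
move=> c; rewrite mulrC -ltr_pdivlMr// => Lc.
have c0 : 0 <= c / N%:R by exact: le_trans (rinv_ge0 L) (ltW Lc).
(* At [c / N] the rate is known to be at least L, whereas the witness needs a strict inequality. The
   bound is therefore proved for each [L' < L], and the limit is taken after a logarithm, a zero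
   probability being treated apart. *)
suff H L' : L' < L -> (P' [set w | (c <= \sum_(i in F) Y i w)%R] <=
    (expR (- (N%:R * L')))%:E)%E.
  have fP : P' [set w | (c <= \sum_(i in F) Y i w)%R] \is a fin_num.
    by apply: fin_num_measure; exact: measurable_ge.
  rewrite -(fineK fP) lee_fin.
  have [p0|p0] := leP (fine (P' [set w | (c <= \sum_(i in F) Y i w)%R])) 0.
    exact: le_trans p0 (expR_ge0 _).
  rewrite -[leLHS](lnK (x := fine _)) ?posrE// ler_expR lerNr mulrC.
  rewrite -ler_pdivlMr//; apply/ler_addgt0Pl => e e0.
  rewrite -lerBlDl; have /H : L - e < L by rewrite ltrBlDr ltrDl.
  rewrite -(fineK fP) lee_fin -{1}[fine _]lnK ?posrE// ler_expR lerNr mulrC.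
  by rewrite -ler_pdivlMr.
move=> LL'.
have : (L'%:E < rate P X (c / N%:R))%E.
  by apply: lt_le_trans (rate_gt_rinv Lc); rewrite lte_fin.
move=> /(rate_mgf_witness c0)[u [M [u0 M1 ME H]]].
apply: le_trans (chernoff_indep_sum c ind u0 M1 _ FJ FN) _.
  move=> i iJ; rewrite -ME.
  apply: (same_law_integral (f := fun x => expR (u * x)) (law i iJ)).
    exact: measurable_expR_mul.
  by move=> x; exact: expR_ge0.
rewrite lee_fin; have -> : M ^+ N * expR (- (u * c)) =
    (M * expR (- (u * (c / N%:R)))) ^+ N.
  rewrite exprMn -expRM_natl; congr (_ * expR _).
  by field; rewrite gt_eqF.
rewrite -(mulrN N%:R L') expRM_natl; apply: lerXn2r => //; rewrite nnegrE ?expR_ge0//.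
by rewrite mulr_ge0 ?expR_ge0// (le_trans ler01).
Qed.

Lemma rinv_bounded M0 : P [set w | M0 < X w] = 0%E -> 0 <= M0 ->
  forall L, rinv L <= M0.
Proof.
move=> PM M00 L; apply/ler_addgt0Pr => e e0.
apply: rinv_le; first by rewrite addr_ge0// ltW.
(* At [M0 + e] the exponent exceeds the bound [u * M0] on [log_mgf] by [u * e], which this choice
   makes equal to the absolute value of L. *)
pose u := `|L| / e; have u0 : 0 <= u by rewrite divr_ge0// ltW.
have mgf_le : ('M_P X u <= (expR (u * M0))%:E)%E.
  rewrite mgfE -[leRHS]mule1 -(probability_setT P) -integral_cst//.
  apply: ae_ge0_le_integral => //.
  - exact: measurable_mgf.
  - by move=> w _; rewrite lee_fin expR_ge0.
  exists [set w | M0 < X w]; split => //.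
    exact: measurable_gt (measurable_funP X).
  move=> w /= H; rewrite ltNge; apply/negP => XM; apply: H => _.
  by rewrite lee_fin ler_expR ler_wpM2l.
apply: le_trans (rate_ub u _).
have : (log_mgf P X u <= (u * M0)%:E)%E.
  have M1 := mgf_ge1 u; rewrite /log_mgf.
  move: mgf_le M1; case: ('M_P X u)%E => [m| |]//; rewrite !lee_fin => mle m1.
  have m0 : 0 < m by exact: lt_le_trans m1.
  by rewrite lne_EFin// lee_fin -ler_expR lnK.
have := log_mgf_ge0 u; case: (log_mgf P X u) => [m| |]//.
rewrite lee_fin => _; rewrite lee_fin => mu; rewrite -EFinB lee_fin.
have -> : u * (M0 + e) = u * M0 + `|L| by rewrite /u; field; rewrite gt_eqF.
by have := ler_norm L; lra.
Qed.

(** The two closed half-lines have equal probability and cover everything. This settles the case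
    below where the essential supremum is 0. *)
Lemma prob_ge0_gt0 : (0 < P [set w | (0 <= X w)%R])%E.
Proof.
have [sym _ _] := X_good.
have m0 := measurable_ge 0 (measurable_funP X).
have E : P [set w | (0 <= X w)%R] = P [set w | (X w <= 0)%R].
  have := sym `[0, +oo[%classic (measurable_itv _).
  rewrite (_ : X @^-1` _ = [set w | 0 <= X w]); last first.
    by apply/seteqP; split=> w /=; rewrite in_itv/= andbT.
  move=> ->; congr (P _); apply/seteqP.
  by split=> w /=; rewrite in_itv/= andbT oppr_ge0.
rewrite lt0e measure_ge0 andbT; apply/eqP => P0.
have : (P setT <= P [set w | (0 <= X w)%R] + P [set w | (X w <= 0)%R])%E.
  have mle : measurable [set w | X w <= 0].
    have := measurable_ge 0 (measurable_funP (\- X)%R).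
    by congr measurable; apply/seteqP; split=> w /=; rewrite oppr_ge0.
  apply: le_trans (measureU2 P m0 mle); apply: le_measure; rewrite ?inE//.
    exact: measurableU.
  by move=> w _ /=; case: (leP 0 (X w)) => H; [left|right => /=; exact: ltW].
by rewrite -E P0 adde0 probability_setT lee_fin ler10.
Qed.

(* Convexity gives [rate ((1 - eps) rinv L) <= (1 - eps) / (1 - eps / 2) * L].
   For bounded [X], where the regularity hypothesis is void, the probability on
   the right is instead bounded below independently of [L]. *)
Lemma tail_ge_rinv eps : 0 < eps < 1 -> exists L0, forall L, L0 <= L ->
  ((expR (- ((1 - eps / 4) * L)))%:E
     <= P [set w | ((1 - eps) * rinv L <= X w)%R])%E.
Proof.
move=> /andP[e0 e1]; have [_ _ reg] := X_good.
have mge c := measurable_ge c (measurable_funP X).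
have mgt c := measurable_gt c (measurable_funP X).
have [unb|bnd] := pselect (forall M, (0 < P [set w | (M < X w)%R])%E); last first.
  have [M1 PM1] : exists M1, P [set w | M1 < X w] = 0%E.
    move/existsNP: bnd => [M1 /negP]; rewrite -leNgt => H; exists M1.
    by apply/eqP; rewrite eq_le H measure_ge0.
  (* [inf S] is the essential supremum of X. It bounds every [rinv L], and the level
     [(1 - eps) * inf S] is reached with a fixed positive probability, which exceeds the left-hand
     side once L is large. *)
  pose S := [set m | 0 <= m /\ P [set w | m < X w] = 0%E].
  have S0 : S (Num.max M1 0).
    split; first by rewrite le_max lexx orbT.
    apply/eqP; rewrite eq_le measure_ge0 andbT -PM1.
    apply: le_measure; rewrite ?inE; try exact: mgt.
    by move=> w /=; rewrite gt_max => /andP[].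
  have lbS : has_inf S by split; [exists (Num.max M1 0)|exists 0 => x []].
  have m0 : 0 <= inf S by apply: lb_le_inf; [exists (Num.max M1 0)|move=> x []].
  have Lm L : rinv L <= inf S.
    apply: lb_le_inf; first by exists (Num.max M1 0).
    by move=> x [x0 Px]; exact: rinv_bounded.
  have p0 : (0 < P [set w | ((1 - eps) * inf S <= X w)%R])%E.
    have [m00|m00] := eqVneq (inf S) 0; first by rewrite m00 mulr0 prob_ge0_gt0.
    have mp : 0 < inf S by rewrite lt_neqAle eq_sym m00.
    rewrite lt0e measure_ge0 andbT; apply/eqP => P0.
    have : S ((1 - eps) * inf S).
      split; first by rewrite mulr_ge0// subr_ge0 ltW.
      apply/eqP; rewrite eq_le measure_ge0 andbT -P0.
      apply: le_measure; rewrite ?inE;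
        [exact: mgt|exact: mge|].
      by move=> w /=; exact: ltW.
    move=> /(ge_inf lbS.2); rewrite leNgt => /negP; apply.
    by rewrite gtr_pMl// gtrBl.
  have fp : P [set w | ((1 - eps) * inf S <= X w)%R] \is a fin_num.
    by apply: fin_num_measure; exact: mge.
  exists (- ln (fine (P [set w | ((1 - eps) * inf S <= X w)%R])) / (1 - eps / 4)).
  move=> L; have e4 : 0 < 1 - eps / 4 by lra.
  rewrite ler_pdivrMr// lerNl [L * _]mulrC => HL.
  apply: (@le_trans _ _ (P [set w | ((1 - eps) * inf S <= X w)%R])).
    rewrite -(fineK fp) lee_fin -[leRHS]lnK ?ler_expR// posrE fine_gt0// p0.
    by rewrite ltey_eq fp.
  apply: le_measure; rewrite ?inE; try exact: mge.
  by move=> w /=; apply: le_trans; rewrite ler_wpM2l// subr_ge0 ltW.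
have [e ecvg etail] := reg unb.
(* An infinite rate at s would bound the tail at s by [expR (- L)] for all L; [1 - ln] of the tail
   probability, which is positive for unbounded X, is an L that contradicts this. *)
have rate_fin s : 0 <= s -> rate P X s \is a fin_num.
  move=> s0; rewrite ge0_fin_numE ?rate_ge0// ltNge leye_eq; apply/negP => /eqP ro.
  have : (0 < P [set w | (s <= X w)%R])%E.
    apply: lt_le_trans (unb s) _; apply: le_measure; rewrite ?inE;
        [exact: mgt|exact: mge|].
    by move=> w /=; exact: ltW.
  have fp : P [set w | (s <= X w)%R] \is a fin_num.
    by apply: fin_num_measure; exact: mge.
  rewrite -(fineK fp) lte_fin => p0.
  have := @tail_le s (1 - ln (fine (P [set w | (s <= X w)%R]))) s0.
  rewrite ro ltry => /(_ isT); rewrite -{1}(fineK fp) lee_fin -{1}[fine _]lnK//.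
  by rewrite ler_expR; lra.
have e4 : 0 < eps / 4 by rewrite divr_gt0.
have : \forall t \near +oo, `|e t| <= eps / 4.
  have /cvgrPdist_le /(_ _ e4) := ecvg.
  by apply: filterS => t; rewrite sub0r normrN.
move=> /(filterI etail) [t0 [_ Ht]].
(* Once L exceeds the rate at [s0], [rinv L] is at least [s0], so that [(1 - eps) * rinv L] passes
   the threshold [t0] of the regularity hypothesis. *)
pose s0 := (`|t0| + 1) / (1 - eps).
have s00 : 0 < s0 by rewrite divr_gt0// ?subr_gt0// ltr_wpDl.
exists (fine (rate P X s0) + 1) => L HL.
have L0 : 0 < L.
  apply: lt_le_trans HL; rewrite ltr_wpDl// fine_ge0// rate_ge0//.
have aL : s0 <= rinv L.
  rewrite leNgt; apply/negP => /rate_gt_rinv.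
  rewrite -(fineK (rate_fin _ (ltW s00))) lee_fin; lra.
have a0 : 0 < rinv L by exact: lt_le_trans aL.
pose t := (1 - eps) * rinv L.
have tt0 : t0 < t.
  have : (1 - eps) * s0 <= t by rewrite ler_wpM2l// subr_ge0 ltW.
  rewrite /s0 mulrC divfK ?gt_eqF ?subr_gt0// => H.
  by have := ler_norm t0; lra.
have [Pt et] := Ht t tt0.
apply: (@le_trans _ _ (P [set w | t < X w])); last first.
  apply: le_measure; rewrite ?inE; [exact: mgt|exact: mge|].
  by move=> w /=; exact: ltW.
have tge0 : 0 <= t by rewrite mulr_ge0 ?subr_ge0 ?ltW.
have ft := rate_fin t tge0.
rewrite Pt -(fineK ft) -EFinM -EFinN /= lee_fin ler_expR lerN2.
set r := fine _.
have r0 : 0 <= r by rewrite fine_ge0 ?rate_ge0.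
(* Scaling t by k stops at [(1 - eps / 2) * rinv L], strictly below [rinv L], where the rate is
   certain to be less than L. *)
pose k := (1 - eps / 2) / (1 - eps).
have k1 : 1 <= k by rewrite ler_pdivlMr ?subr_gt0//; lra.
have kr : k * r <= L.
  have := rate_scale t k1.
  have -> : k * t = (1 - eps / 2) * rinv L.
    by rewrite /k /t; field; rewrite gt_eqF ?subr_gt0.
  rewrite -(fineK ft) -EFinM => H; rewrite -lee_fin.
  apply: le_trans H _; apply/ltW/rate_lt_rinv.
    by rewrite mulr_ge0 ?rinv_ge0//; lra.
  by rewrite gtr_pMl//; lra.
have kr' : (1 - eps / 2) * r <= (1 - eps) * L.
  have e1' : 0 < 1 - eps by rewrite subr_gt0.
  move: kr; rewrite /k mulrAC ler_pdivrMr// => /le_trans; apply.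
  by rewrite mulrC.
have : (1 + e t) * r <= (1 + eps / 4) * r.
  by rewrite ler_wpM2r// lerD2l (le_trans (ler_norm _)).
move=> /le_trans; apply.
(* It remains that [(1 + eps / 4) (1 - eps) <= (1 - eps / 4) (1 - eps / 2)]: the first-order terms
   agree, and the second-order terms have the right signs. *)
rewrite -(ler_pM2l (_ : 0 < 1 - eps / 2)); last by lra.
rewrite mulrCA.
apply: (@le_trans _ _ ((1 + eps / 4) * ((1 - eps) * L))).
  by rewrite ler_wpM2l//; lra.
rewrite !mulrA ler_wpM2r ?(ltW L0)//.
have : 0 <= eps * eps by rewrite mulr_ge0 ?ltW.
lra.
Qed.

End Rate.

(** * Union bound, second moment, and convergence with high probability *)

Lemma cvg_prob1 (R : realType) (u : nat -> \bar R) :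
  (forall n, (0 <= u n)%E) -> (forall n, (u n <= 1)%E) ->
  (forall e : R, 0 < e -> \forall n \near \oo, ((1 - e)%:E <= u n)%E) ->
  u n @[n --> \oo] --> 1%E.
Proof.
move=> u0 u1 H.
have uE n : u n = (fine (u n))%:E.
  by rewrite fineK// ge0_fin_numE// (le_lt_trans (u1 n)) ?ltry.
rewrite (funext uE); apply: cvg_EFin; first exact: nearW.
apply/cvgrPdist_le => e e0; near=> n.
have := u1 n; rewrite uE lee_fin => u1n.
rewrite /= ger0_norm ?subr_ge0// lerBlDr addrC -lerBlDr.
by rewrite -lee_fin -uE; near: n; exact: H.
Unshelve. all: by end_near. Qed.

(* [eps n] is [1 / (k + 2)] for the largest [k <= n] such that the estimate with
   this [eps] has probability at least [1 - 1 / (k + 1)]. *)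
Lemma whp_asymptotic_of_forall (R : realType) (d : nat -> measure_display)
    (T : forall n, measurableType (d n)) (P : forall n, probability (T n) R)
    (W : forall n, T n -> \bar R) (a : nat -> \bar R) :
  (forall n x y, measurable [set w | (x <= W n w <= y)%E]) ->
  (forall eps e : R, 0 < eps < 1 -> 0 < e -> \forall n \near \oo,
     ((1 - e)%:E <=
      P n [set w | ((1 - eps)%:E * a n <= W n w <= (1 + eps)%:E * a n)%E])%E) ->
  whp_asymptotic P W a.
Proof.
move=> mW H.
pose A n (eps : R) :=
  [set w | ((1 - eps)%:E * a n <= W n w <= (1 + eps)%:E * a n)%E].
(* The index 0 always qualifies, its threshold being 0, so the maximum exists; the denominator k + 2
   keeps the tolerance below 1. *)
pose ok n (k : 'I_n.+1) := ((1 - k.+1%:R^-1)%:E <= P n (A n (k.+2%:R^-1)%R))%E.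
have ok0 n : ok n ord0 by rewrite /ok invr1 subrr.
pose k n := [arg max_(i > ord0 | ok n i) (i : nat)].
have kP n : ok n (k n) /\ forall j, ok n j -> (j <= k n)%N.
  by rewrite /k; case: arg_maxnP.
have k_large K : \forall n \near \oo, (K <= k n)%N.
  have h1 : 0 < (K.+2%:R^-1 : R) < 1 by rewrite invr_gt0 ltr0n invf_lt1// ltr1n.
  have h2 : 0 < (K.+1%:R^-1 : R) by rewrite invr_gt0 ltr0n.
  have [N _ HN] := H _ _ h1 h2.
  exists (maxn N K) => // n /=; rewrite geq_max => /andP[Nn Kn].
  have /(_ (Ordinal (Kn : (K < n.+1)%N))) := (kP n).2.
  by apply; exact: HN.
have small (e : R) : 0 < e -> \forall n \near \oo, (k n).+1%:R^-1 <= e.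
  move=> e0; have [N _ HN] := near_infty_natSinv_lt (PosNum e0).
  apply: filterS (k_large N) => n Nk.
  by have /ltW := HN (k n) Nk.
exists (fun n => (k n).+2%:R^-1).
  apply/cvgrPdist_le => e e0; apply: filterS (small e e0) => n; apply: le_trans.
  rewrite sub0r normrN ger0_norm ?invr_ge0// lef_pV2 ?posrE//.
  by rewrite ler_nat.
apply: cvg_prob1 => //; first by move=> n; exact: probability_le1.
move=> e e0; apply: filterS (small e e0) => n kn.
by apply: le_trans (kP n).1; rewrite lee_fin lerD2l lerN2.
Qed.

Section Probability.
Context d (T : measurableType d) (R : realType) (P : probability T R).

Lemma prob_compl_sub (A B : set T) (e : R) : measurable A -> measurable B ->
  ~` B `<=` A -> (P B <= e%:E)%E -> ((1 - e)%:E <= P A)%E.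
Proof.
move=> mA mB BA Pe; apply: (@le_trans _ _ (P (~` B))).
  by rewrite probability_setC// EFinB leeB.
by apply: le_measure; rewrite ?inE//; exact: measurableC.
Qed.

Lemma union_bound (I : finType) (Q : pred I) (A : I -> set T) (b : I -> R) :
  (forall i, Q i -> measurable (A i)) ->
  (forall i, Q i -> (P (A i) <= (b i)%:E)%E) ->
  measurable [set w | exists i, Q i /\ A i w] /\
  (P [set w | exists i, Q i /\ A i w] <= (\sum_(i | Q i) b i)%:E)%E.
Proof.
move=> mA PA.
pose U (s : seq I) := [set w | exists i, [/\ i \in s, Q i & A i w]].
suff H s : measurable (U s) /\ (P (U s) <= (\sum_(i <- s | Q i) b i)%:E)%E.
  rewrite (_ : [set w | _] = U (index_enum I)); first exact: H.
  apply/seteqP; split => w [i]; last by move=> [_ Qi Ai]; exists i.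
  by move=> [Qi Ai]; exists i; split => //; exact: mem_index_enum.
elim: s => [|i s [mU PU]].
  rewrite (_ : U [::] = set0) ?measure0 ?big_nil//.
  by apply/seteqP; split => // w [i []].
have [Qi|Qi] := boolP (Q i); last first.
  rewrite big_cons (negPf Qi) (_ : U (i :: s) = U s)//.
  apply/seteqP; split => w [j [js Qj Aj]]; exists j; split => //.
    by move: js; rewrite inE => /predU1P[ji|//]; rewrite ji (negPf Qi) in Qj.
  by rewrite inE js orbT.
rewrite big_cons Qi (_ : U (i :: s) = A i `|` U s); last first.
  apply/seteqP; split => w.
    move=> [j [js Qj Aj]]; move: js; rewrite inE => /predU1P[<-|js]; first by left.
    by right; exists j.
  move=> [Ai|[j [js Qj Aj]]]; first by exists i; rewrite mem_head.
  by exists j; split => //; rewrite inE js orbT.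
split; first by apply: measurableU => //; exact: mA.
rewrite EFinD; apply: le_trans (measureU2 P (mA i Qi) mU) _.
by rewrite leeD// PA.
Qed.

Lemma integral_sum_indic (K : finType) (c : K -> R) (A : K -> set T) :
  (forall k, 0 <= c k) -> (forall k, measurable (A k)) ->
  (\int[P]_w (\sum_k c k * \1_(A k) w)%:E = (\sum_k c k * fine (P (A k)))%:E)%E.
Proof.
move=> c0 mA.
under eq_integral do rewrite -sumEFin.
rewrite ge0_integral_sum//; last 2 first.
- by move=> k; apply/measurable_EFinP; apply: measurable_funM.
- by move=> k w _; rewrite lee_fin mulr_ge0// indicE ler0n.
rewrite -sumEFin; apply: eq_bigr => k _.
under eq_integral do rewrite EFinM.
rewrite ge0_integralZl ?lee_fin//; last first.
  by apply/measurable_EFinP; exact: measurable_indic.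
by rewrite integral_indic// setIT EFinM fineK// fin_num_measure.
Qed.

(* Integrate [1_{N = 0} + 2 N / mu <= 1 + N^2 / mu^2], where [N] counts the
   events that occur. *)
Lemma second_moment (K : finType) (A : K -> set T) (mu S : R) :
  (forall k, measurable (A k)) -> 0 < mu ->
  \sum_k fine (P (A k)) = mu ->
  \sum_k \sum_l fine (P (A k `&` A l)) <= S ->
  (P [set w | forall k, ~ A k w] <= (S / mu ^+ 2 - 1)%:E)%E.
Proof.
move=> mA mu0 muE SE.
pose B := [set w | forall k, ~ A k w].
have mB : measurable B.
  rewrite (_ : B = \bigcap_(k in [set: K]) ~` A k).
    apply: fin_bigcap_measurable; first exact: finite_finset.
    by move=> k _; exact: measurableC.
  by apply/seteqP; split => w H k; [move=> _; exact: H|exact: H].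
(* [None] carries the term outside the sum, [\1_B] on the left and the constant 1 on the right, so
   each side is a single weighted sum of indicators. *)
pose c (k : option K) : R := if k is Some _ then 2 / mu else 1.
pose AB (k : option K) := if k is Some k then A k else B.
pose c2 (k : option (K * K)) : R := if k is Some _ then mu ^- 2 else 1.
pose A2 (k : option (K * K)) := if k is Some k then A k.1 `&` A k.2 else setT.
have c0 k : 0 <= c k by case: k => [k|]//=; rewrite divr_ge0// ltW.
have c20 k : 0 <= c2 k by case: k => [k|]//=; rewrite invr_ge0 exprn_ge0// ltW.
have mAB k : measurable (AB k) by case: k.
have mA2 k : measurable (A2 k) by case: k => //= k; exact: measurableI.
have big_opt (I : finType) (F : option I -> R) :
    \sum_k F k = F None + \sum_i F (Some i).
  rewrite (bigD1 None)//=; congr (_ + _).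
  rewrite (reindex_omap Some id) /=; last by case.
  by apply: eq_bigl => i; rewrite eqxx.
have : (\int[P]_w (\sum_k c k * \1_(AB k) w)%:E <=
        \int[P]_w (\sum_k c2 k * \1_(A2 k) w)%:E)%E.
  apply: ge0_le_integral => //.
  - move=> w _; rewrite lee_fin; apply: sumr_ge0 => k _.
    by rewrite mulr_ge0// indicE ler0n.
  - apply/measurable_EFinP; apply: measurable_sum => k.
    by apply: measurable_funM => //; exact: measurable_indic.
  - apply/measurable_EFinP; apply: measurable_sum => k.
    by apply: measurable_funM => //; exact: measurable_indic.
  move=> w _; rewrite lee_fin !big_opt /= -!mulr_sumr.
  pose N := \sum_k \1_(A k) w : R.
  rewrite [X in 2 / mu * X](_ : _ = N)//.
  have -> : \sum_(i : K * K) \1_(A i.1 `&` A i.2) w = N * N :> R.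
    rewrite /N mulr_suml -(pair_bigA _ (fun i j => \1_(A i `&` A j) w))/=.
    apply: eq_bigr => i _; rewrite mulr_sumr; apply: eq_bigr => j _.
    by rewrite indicI.
  rewrite indicT !mul1r.
  have [/eqP NB|NB] := boolP (N == 0).
    by rewrite NB !mulr0 !addr0 /= indicE lern1 leq_b1.
  have -> : \1_B w = 0 :> R.
    rewrite indicE; case: (boolP (w \in B)) => //; rewrite inE => Bw.
    move: NB; rewrite /N big1 ?eqxx// => k _.
    by rewrite indicE memNset//; exact: Bw.
  rewrite add0r -subr_ge0.
  have -> : 1 + mu ^- 2 * (N * N) - 2 / mu * N = (N / mu - 1) ^+ 2.
    by field; rewrite gt_eqF.
  exact: sqr_ge0.
rewrite !integral_sum_indic// lee_fin !big_opt /= -!mulr_sumr muE !mul1r.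
rewrite divfK ?gt_eqF// probability_setT /=.
rewrite -(pair_bigA _ (fun i j => fine (P (A i `&` A j))))/= => H.
have fB : P B \is a fin_num by exact: fin_num_measure.
rewrite -(fineK fB) lee_fin.
have : mu ^- 2 * (\sum_i \sum_j fine (P (A i `&` A j))) <= S / mu ^+ 2.
  by rewrite mulrC ler_wpM2r// invr_ge0 exprn_ge0// ltW.
lra.
Qed.

Lemma measurable_max_weight (I : finType) (C : set (graph I))
    (Y : {set I} -> {RV P >-> R}) :
  measurable_fun setT (fun w => max_weight C (fun e => Y e w)).
Proof.
rewrite /max_weight; elim: (index_enum _) => [|H s IH].
  by under eq_fun do rewrite big_nil; exact: measurable_cst.
have [HC|/negPf HC] := boolP (H \in C); last first.
  by under eq_fun do rewrite big_cons HC; exact: IH.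
under eq_fun do rewrite big_cons HC.
apply: measurable_maxe => //.
apply/measurable_EFinP.
by under eq_fun do rewrite -big_enum/=; exact: measurable_sum.
Qed.

Lemma measurable_max_weight_itv (I : finType) (C : set (graph I))
    (Y : {set I} -> {RV P >-> R}) (x y : \bar R) :
  measurable [set w | (x <= max_weight C (fun e => Y e w) <= y)%E].
Proof.
have := @measurable_max_weight I C Y measurableT `[x, y]%classic (emeasurable_itv _).
by rewrite setTI.
Qed.

End Probability.

Lemma max_weight_le (R : realType) (I : finType) (C : set (graph I))
    (x : {set I} -> R) (b : R) :
  (forall H, C H -> \sum_(e in edges H) x e <= b) -> (max_weight C x <= b%:E)%E.
Proof.
move=> H; rewrite /max_weight; elim/big_ind: _ => //.
- exact: leNye.
- by move=> u v ub vb; rewrite ge_max ub vb.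
- by move=> G; rewrite inE lee_fin; exact: H.
Qed.

Lemma max_weight_ge (R : realType) (I : finType) (C : set (graph I))
    (x : {set I} -> R) (b : R) (H : graph I) :
  C H -> b <= \sum_(e in edges H) x e -> (b%:E <= max_weight C x)%E.
Proof.
move=> CH bH; rewrite /max_weight (bigD1 H)/=; last by rewrite inE.
by rewrite le_max lee_fin bH.
Qed.

Lemma sum_powerset_exp (R : realType) (I : finType) (J : {set I}) (x : R) :
  \sum_(F : {set I} | F \subset J) x ^+ #|F| = (1 + x) ^+ #|J|.
Proof.
rewrite exprDn; under [RHS]eq_bigr do rewrite expr1n mul1r.
rewrite (partition_big (fun F : {set I} => inord #|F|) (fun k : 'I_#|J|.+1 => true))//=.
apply: eq_bigr => k _; rewrite -cards_draws -sumr_const.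
apply: eq_big => F.
  rewrite inE; case: (boolP (F \subset J)) => //= FJ.
  by rewrite -val_eqE /= inordK// ltnS subset_leq_card.
by move=> /andP[FJ /eqP <-]; rewrite inordK// ltnS subset_leq_card.
Qed.

(** * Spanning trees, Hamilton cycles and paths *)

Lemma near_ln_ge (R : realType) (M : R) : \forall n \near \oo, M <= ln n%:R.
Proof.
apply: filterS (nbhs_infty_ger (expR M)) => n Mn.
by rewrite -[M]expRK ler_ln ?posrE ?expR_gt0// (lt_le_trans (expR_gt0 M)).
Qed.

Lemma expRN_le_inv (R : realType) (t : R) : 0 < t -> expR (- t) <= t^-1.
Proof.
move=> t0; rewrite expRN lef_pV2 ?posrE ?expR_gt0//.
by apply: le_trans (expR_ge1Dx _); rewrite lerDr.
Qed.

Lemma heavy_sum (R : realType) (I : finType) (E E0 J : {set I}) (x : I -> R)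
    (h b : R) (N k : nat) :
  E0 \subset E -> E \subset J -> (#|E| <= N)%N -> (N <= #|E0| + k)%N ->
  0 <= h -> 0 <= b -> (forall e, e \in E0 -> h <= x e) ->
  (forall e, e \in J -> - b <= x e) ->
  (N%:R - k%:R) * h - k%:R * b <= \sum_(e in E) x e.
Proof.
move=> E0E EJ EN Nk h0 b0 xh xb.
rewrite (finset.big_setID E0)/= (finset.setIidPr E0E).
apply: lerD.
  apply: (@le_trans _ _ (\sum_(e in E0) h)); last by apply: ler_sum.
  by rewrite sumr_const -[leRHS]mulr_natl ler_wpM2r// lerBlDr -natrD ler_nat.
apply: (@le_trans _ _ (\sum_(e in (E :\: E0)%SET) (- b))); last first.
  apply: ler_sum => e; rewrite finset.in_setD => /andP[_ eE].
  by apply: xb; exact: (fintype.subsetP EJ).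
rewrite sumr_const mulNrn lerN2 -[leLHS]mulr_natl ler_wpM2r// ler_nat.
by rewrite finset.cardsDS//; lia.
Qed.

Lemma expr_ratio_ge1 (R : realFieldType) (x : R) (k m : nat) :
  1 <= x -> (k <= m)%N -> 1 <= x ^+ m * x^-1 ^+ k.
Proof.
move=> x1 km; rewrite exprVn -{1}(subnK km) exprD mulfK ?exprn_ege1//.
by rewrite expf_neq0// gt_eqF// (lt_le_trans ltr01).
Qed.

Section FixedSize.
Context (R : realType) (d0 : measure_display) (T0 : measurableType d0)
  (P0 : probability T0 R) (X : {RV P0 >-> R}).
Hypothesis X_good : good P0 X.
Context (d : measure_display) (T : measurableType d) (P : probability T R).
Variables (n : nat) (Y : {set 'I_n} -> {RV P >-> R}).
Let J := edges (complete_graph 'I_n).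
Hypothesis law : forall e, e \in J -> same_law P (Y e) P0 X.
Hypothesis ind : independent P J (fun e => Y e : T -> R).
Hypothesis n_gt0 : (0 < n)%N.

Let measurable_sumY (F : {set {set 'I_n}}) :
  measurable_fun setT (fun w => \sum_(e in F) Y e w).
Proof. by under eq_fun do rewrite -big_enum/=; exact: measurable_sum. Qed.

Lemma card_J : #|J| = 'C(n, 2).
Proof. by rewrite /J /edges /= card_draws card_ord. Qed.

Lemma card_J_le : (#|J| <= n * n)%N.
Proof.
rewrite card_J bin2; apply: (@leq_trans (n * n.-1)); first by lia.
by rewrite leq_mul2l leq_pred orbT.
Qed.

(* Since [n ^ (n - |F|) >= 1], the number of edge sets with at most [n] edges is
   at most [n ^ n (1 + 1 / n) ^ (n ^ 2) <= (e n) ^ n]. *)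
Lemma sparse_sum_le (eps : R) : 0 < eps ->
  exists B, [/\ measurable B,
    (P B <= (expR (n%:R * (1 - eps * ln n%:R)))%:E)%E
    & forall w, ~ B w -> forall F : {set {set 'I_n}}, F \subset J ->
        (#|F| <= n)%N ->
        \sum_(e in F) Y e w <= n%:R * rinv X ((1 + eps) * ln n%:R)].
Proof.
move=> e0; set L := ln n%:R; set b := n%:R * rinv X _.
have nR : 0 < n%:R :> R by rewrite ltr0n.
pose Q (F : {set {set 'I_n}}) := (F \subset J) && (#|F| <= n)%N.
pose A (F : {set {set 'I_n}}) := [set w | b < \sum_(e in F) Y e w].
have [mB PB] := @union_bound _ _ _ P _ Q A
  (fun=> expR (- (n%:R * ((1 + eps) * L))))
  (fun F _ => measurable_gt b (measurable_sumY F))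
  (fun F HF => let: conj FJ Fn := andP HF in
    chernoff_sum X_good ((1 + eps) * L) ind law FJ Fn n_gt0).
exists [set w | exists F, Q F /\ A F w]; split => //; last first.
  move=> w nB F FJ Fn; rewrite leNgt; apply/negP => bF; apply: nB.
  by exists F; split => //; rewrite /Q FJ Fn.
apply: le_trans PB _; rewrite lee_fin; set b0 := expR (- _).
apply: (@le_trans _ _ (\sum_(F : {set {set 'I_n}} | F \subset J)
    n%:R ^+ n * b0 * n%:R^-1 ^+ #|F|)).
  rewrite big_mkcond [leRHS]big_mkcond; apply: ler_sum => F _; rewrite /Q.
  have b00 : 0 <= b0 by exact: expR_ge0.
  case: (F \subset J) => //=; case: leqP => Fn; last first.
    by rewrite !mulr_ge0 ?exprn_ge0 ?invr_ge0.
  by rewrite mulrAC ler_peMl// expr_ratio_ge1// ler1n.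
rewrite -mulr_sumr sum_powerset_exp.
apply: (@le_trans _ _ (n%:R ^+ n * b0 * expR n%:R)).
  rewrite ler_wpM2l ?mulr_ge0 ?exprn_ge0 ?expR_ge0//.
  apply: (@le_trans _ _ (expR n%:R^-1 ^+ #|J|)).
    by rewrite lerXn2r ?nnegrE ?expR_ge0 ?addr_ge0 ?invr_ge0 ?expR_ge1Dx.
  rewrite -expRM_natl ler_expR ler_pdivrMr// -natrM ler_nat.
  exact: card_J_le.
have -> : n%:R ^+ n = expR (n%:R * L) by rewrite expRM_natl lnK ?posrE.
rewrite /b0.
by rewrite -!expRD ler_expR; lra.
Qed.

(** The factor 3 gives each edge a failure probability [n ^ (- 3)], against at most [n ^ 2] edges.
    Symmetry reduces the lower tail to Chernoff's bound for a single edge. *)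
Lemma all_edges_ge : exists B, [/\ measurable B, (P B <= (n%:R^-1)%:E)%E
    & forall w, ~ B w -> forall e, e \in J ->
        - rinv X (3 * ln n%:R) <= Y e w].
Proof.
set r := rinv X _.
have nR : 0 < n%:R :> R by rewrite ltr0n.
have r0 : 0 <= r by exact: rinv_ge0.
pose A (e : {set 'I_n}) := [set w | Y e w < - r].
have mA e : measurable (A e).
  have := measurable_gt r (measurable_funP (\- Y e)%R).
  by congr measurable; apply/seteqP; split => w /=; rewrite ltrNr.
have PA e : e \in J -> (P (A e) <= (expR (- (3 * ln n%:R)))%:E)%E.
  move=> eJ; have [sym _ _] := X_good.
  have itv1 : (Y e) @^-1` `]-oo, (- r)[%classic = A e.
    by apply/seteqP; split => w /=; rewrite in_itv.
  have itv2 : (\- X)%R @^-1` `]-oo, (- r)[%classic = X @^-1` `]r, +oo[%classic.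
    by apply/seteqP; split => w /=; rewrite !in_itv/= ltrN2 andbT.
  rewrite -itv1 law// sym// itv2 -(law eJ)//.
  have e1 : ([set e] \subset J)%SET by rewrite finset.sub1set.
  have := @chernoff_sum _ _ _ _ _ X_good _ _ _ _ _ _ _ 1 (3 * ln n%:R) ind law e1.
  rewrite cards1 !mul1r => /(_ isT isT); apply: le_trans.
  rewrite le_eqVlt; apply/orP; left; apply/eqP; congr (P _).
  by apply/seteqP; split => w /=; rewrite in_itv/= andbT finset.big_set1.
have [mB PB] := union_bound (Q := [in J]) (fun e _ => mA e) PA.
exists [set w | exists e, e \in J /\ A e w]; split => //; last first.
  move=> w nB e eJ; rewrite leNgt; apply/negP => H; apply: nB.
  by exists e.
apply: le_trans PB _; rewrite lee_fin sumr_const.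
have -> : 3 * ln n%:R = ln (n%:R ^+ 3) :> R by rewrite lnXn// mulr_natl.
rewrite -lnV ?posrE ?exprn_gt0// lnK ?posrE ?invr_gt0 ?exprn_gt0//.
rewrite -[leLHS]mulr_natl ler_pdivrMr ?exprn_gt0// exprS mulKf ?gt_eqF//.
by rewrite expr2 -natrM ler_nat card_J_le.
Qed.

(** The [m * m] edges between disjoint S and U are distinct and independent, so all are light with
    probability at most [expR (- p) ^ (m * m)]; there are at most [4 ^ n <= expR (2 n)] pairs. *)
Lemma bipartite_heavy (h p : R) (m : nat) : 0 <= p ->
  (p%:E <= P0 [set w | (h <= X w)%R])%E ->
  exists B, [/\ measurable B,
    (P B <= (expR (2 * n%:R - p * (m * m)%:R))%:E)%E
    & forall w, ~ B w -> forall S U : {set 'I_n}, (S :&: U = finset.set0)%SET ->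
        #|S| = m -> #|U| = m ->
        exists u v, [/\ u \in S, v \in U & h <= Y [set u; v]%SET w]].
Proof.
move=> p0 hp.
pose E (SU : {set 'I_n} * {set 'I_n}) : {set {set 'I_n}} :=
  [set [set z.1; z.2]%SET | z in finset.setX SU.1 SU.2]%SET.
pose Q (SU : {set 'I_n} * {set 'I_n}) :=
  [&& (SU.1 :&: SU.2)%SET == finset.set0, #|SU.1| == m & #|SU.2| == m].
have QE SU : Q SU -> E SU \subset J /\ #|E SU| = (m * m)%N.
  move=> /and3P[/eqP SU0 /eqP Sm /eqP Um].
  have dis u v : u \in SU.1 -> v \in SU.2 -> u != v.
    move=> uS vU; apply/eqP => uv; have : u \in (SU.1 :&: SU.2)%SET.
      by rewrite finset.in_setI uS uv.
    by rewrite SU0 finset.in_set0.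
  split.
    apply/fintype.subsetP => _ /imsetP[[u v] /finset.setXP[/= uS vU] ->].
    by rewrite inE cards2 dis.
  rewrite card_in_imset ?finset.cardsX ?Sm ?Um// => -[u v] [u' v'].
  move=> /finset.setXP[/= uS vU] /finset.setXP[/= u'S v'U] uv.
  have : u \in [set u'; v']%SET by rewrite -uv finset.set21.
  have : v \in [set u'; v']%SET by rewrite -uv finset.set22.
  rewrite !finset.in_set2 [u == v'](negPf (dis _ _ uS v'U)).
  by rewrite eq_sym (negPf (dis _ _ u'S vU)) orbF /= => /eqP-> /eqP->.
pose lt_h : set R := `]-oo, h[%classic.
have mlt : measurable lt_h by exact: measurable_itv.
pose A SU := [set w | forall e, e \in E SU -> lt_h (Y e w)].
have mA SU : measurable (A SU) by exact: (measurable_all_in (E SU) Y (B := fun=> lt_h)).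
have Plt e : e \in J -> (P (Y e @^-1` lt_h) <= (expR (- p))%:E)%E.
  move=> eJ; rewrite law//.
  rewrite (_ : X @^-1` lt_h = ~` [set w | h <= X w]); last first.
    by apply/seteqP; split => w /=; rewrite /lt_h/= in_itv/= ltNge => /negP.
  rewrite probability_setC; last exact: measurable_ge (measurable_funP X).
  apply: (@le_trans _ _ (1 - p%:E)%E); first by rewrite leeB.
  by rewrite -EFinB lee_fin; have := expR_ge1Dx (- p); lra.
have PA SU : Q SU -> (P (A SU) <= (expR (- (p * (m * m)%:R)))%:E)%E.
  move=> /QE[EJ <-]; rewrite (ind (B := fun=> lt_h) EJ)//.
  have fP e : P (Y e @^-1` lt_h) \is a fin_num.
    apply: fin_num_measure; rewrite -[X in measurable X]setTI.
    exact: measurable_funP.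
  under eq_bigr => e _ do rewrite -(fineK (fP e)).
  rewrite prodEFin lee_fin -mulNr expRM_natr -prodr_const; apply: ler_prod => e eE.
  rewrite fine_ge0//= -lee_fin fineK// Plt//.
  exact: (fintype.subsetP EJ).
have [mB PB] := union_bound (fun SU _ => mA SU) PA.
exists [set w | exists SU, Q SU /\ A SU w]; split => //; last first.
  move=> w nB S U SU0 Sm Um; apply: contrapT => H; apply: nB.
  exists (S, U); split; first by rewrite /Q /= SU0 Sm Um !eqxx.
  move=> _ /imsetP[[u v] /finset.setXP[/= uS vU] ->]; rewrite /lt_h /= in_itv/=.
  by rewrite ltNge; apply/negP => hY; apply: H; exists u, v.
apply: le_trans PB _; rewrite lee_fin sumr_const expRD -[leLHS]mulr_natl.
rewrite ler_wpM2r ?expR_ge0//.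
apply: (@le_trans _ _ ((2 ^ n) ^ 2)%:R).
  rewrite ler_nat; apply: leq_trans (max_card _) _.
  by rewrite card_prod -cardsT -powersetT card_powerset cardsT card_ord.
rewrite expRM_natl natrX lerXn2r ?nnegrE ?expR_ge0 ?ler0n//.
rewrite natrX -[n%:R]mulr1 expRM_natl lerXn2r ?nnegrE ?expR_ge0 ?ler0n//.
by have := expR_ge1Dx (1 : R); lra.
Qed.

End FixedSize.

(** The height [1 - eps / 2] leaves [eps * n / 2] times a to spend. Each of the k other edges costs
    at most 4 a, namely a not collected and 3 a of negative weight. In total this is at most
    [eps * n / 4 + 12] times a, and [64 <= eps * n] absorbs the 12. *)
Lemma linear_weight_bound (R : realFieldType) (eps n a b k : R) :
  0 <= a -> 0 <= k -> 0 < eps -> b <= 3 * a -> k <= eps * n / 16 + 3 ->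
  64 <= eps * n ->
  (1 - eps) * (n * a) <= (n - k) * ((1 - eps / 2) * a) - k * b.
Proof.
move=> a0 k0 eps0 ba kn epsn.
have h : 0 <= a * (eps * n / 2 - 4 * k + k * eps / 2).
  rewrite mulr_ge0//; have : 0 <= k * eps by rewrite mulr_ge0// ltW.
  by move: (eps * n) (k * eps) epsn kn => t u; lra.
have h2 : 0 <= k * (3 * a - b) by rewrite mulr_ge0// subr_ge0.
rewrite -subr_ge0; have -> : (n - k) * ((1 - eps / 2) * a) - k * b -
    (1 - eps) * (n * a) =
    a * (eps * n / 2 - 4 * k + k * eps / 2) + k * (3 * a - b) by field.
exact: addr_ge0.
Qed.

(** With [m >= eps * n / 64] the right-hand side is at least [n ^ (1 + eps / 8) (eps / 64) ^ 2].
    Asking for 3 n leaves [expR (- n)] after the [expR (2 n)] of the union bound. *)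
Lemma bipartite_exponent (R : realType) (eps n m L : R) :
  0 < eps -> 0 < n -> expR L = n -> 3 * (64 / eps) ^+ 2 <= expR (eps / 8 * L) ->
  eps * n / 64 <= m -> 3 * n <= expR (- ((1 - eps / 8) * L)) * m ^+ 2.
Proof.
move=> eps0 n0 expL cL m_ge.
have -> : expR (- ((1 - eps / 8) * L)) = expR (eps / 8 * L) / n.
  by rewrite -expL -expRN -expRD; congr expR; ring.
have t0 : 0 <= eps * n / 64 by rewrite divr_ge0// mulr_ge0 ?ltW.
have -> : 3 * n = 3 * (64 / eps) ^+ 2 / n * (eps * n / 64) ^+ 2.
  by field; rewrite !gt_eqF.
apply: ler_pM.
- by rewrite divr_ge0 ?(ltW n0)// mulr_ge0// sqr_ge0.
- exact: sqr_ge0.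
- by rewrite ler_wpM2r// invr_ge0 ltW.
- by rewrite lerXn2r ?nnegrE// (le_trans t0).
Qed.

(** Two properties of the class suffice: its members have at most n edges, and every Hamilton path
    between the first two vertices extends to a member. *)
Lemma whp_linear (R : realType)
    (d0 : measure_display) (T0 : measurableType d0) (P0 : probability T0 R)
    (X : {RV P0 >-> R}) (hX : good P0 X)
    (d : nat -> measure_display) (T : forall n, measurableType (d n))
    (P : forall n, probability (T n) R)
    (Xe : forall n, {set 'I_n} -> {RV (P n) >-> R})
    (hlaw : forall n (e : {set 'I_n}), e \in edges (complete_graph 'I_n) ->
       same_law (P n) (Xe n e) P0 X)
    (hind : forall n, independent (P n) (edges (complete_graph 'I_n))
       (fun e => Xe n e : T n -> R))
    (C : forall n, set (graph 'I_n)) :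
  (forall n H, C n H -> (#|edges H| <= n)%N) ->
  (forall n (v0 v1 : 'I_n) s, (3 <= n)%N -> v0 = 0%N :> nat -> v1 = 1%N :> nat ->
     uniq (v0 :: s) -> last v0 s = v1 -> [set:: v0 :: s]%SET = [set: 'I_n]%SET ->
     exists H, C n H /\ walk_edges v0 s \subset edges H) ->
  whp_asymptotic P (fun n w => max_weight (C n) (fun e => Xe n e w))
    (fun n => (n%:R%:E * rate_inv P0 X (ln n%:R))%E).
Proof.
move=> Cn Cham; apply: whp_asymptotic_of_forall.
  by move=> n x y; exact: measurable_max_weight_itv.
move=> eps e /andP[eps0 eps1] e0.
have [L0 HL0] : exists L0, forall L, L0 <= L ->
    ((expR (- ((1 - eps / 8) * L)))%:E
     <= P0 [set w | ((1 - eps / 2) * rinv X L <= X w)%R])%E.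
  have [|L0 HL0] := @tail_ge_rinv _ _ _ _ _ hX (eps / 2).
    by apply/andP; split; lra.
  exists L0 => L LL0; have := HL0 L LL0.
  by rewrite (_ : eps / 2 / 4 = eps / 8)//; field.
near=> n.
have n3 : (3 <= n)%N by near: n; exact: nbhs_infty_ge.
have n0 : (0 < n)%N by exact: leq_trans n3.
have nR : 0 < n%:R :> R by rewrite ltr0n.
have neps : 64 / eps <= n%:R by near: n; exact: nbhs_infty_ger.
(* The three bad events will each have probability at most 1 / n. Among the conditions below, [L2]
   turns [n (1 - eps L)] into at most - n, and [L3] serves [bipartite_exponent]. *)
have ne : 3 / e <= n%:R by near: n; exact: nbhs_infty_ger.
have LL0 : L0 <= ln n%:R by near: n; exact: near_ln_ge.
have L2 : 2 / eps <= ln n%:R by near: n; exact: near_ln_ge.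
have L3 : 3 * (64 / eps) ^+ 2 / (eps / 8) <= ln n%:R.
  by near: n; exact: near_ln_ge.
have [L LE] : exists L : R, L = ln n%:R by exists (ln n%:R).
rewrite -LE in LL0 L2 L3 *.
have Lpos : 0 < L by apply: lt_le_trans L2; rewrite divr_gt0.
have epsL : 2 <= eps * L by rewrite mulrC -ler_pdivrMr.
have epsn : 64 <= eps * n%:R by rewrite mulrC -ler_pdivrMr.
have expL : expR L = n%:R by rewrite LE lnK ?posrE.
have a0 : 0 <= rinv X L by exact: rinv_ge0.
(* The upper bound keeps the number [2 m + 3] of uncontrolled edges below [eps n / 16 + 3]; rounding
   down loses at most half because [eps n >= 64]. *)
have [m [m_le m_ge]] : exists m : nat,
    m%:R <= eps * n%:R / 32 /\ eps * n%:R / 64 <= m%:R.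
  have t0 : 0 <= eps * n%:R / 32 by rewrite divr_ge0// mulr_ge0// ltW.
  have [m Hm] : exists m : nat, m%:R <= eps * n%:R / 32 < m.+1%:R.
    by exists (Num.truncn (eps * n%:R / 32)); exact: truncn_itv.
  exists m; move: Hm; rewrite -[m.+1%:R]natr1; move: (eps * n%:R) epsn => t t64.
  by move=> /andP[]; split; lra.
have pm : 3 * n%:R <= expR (- ((1 - eps / 8) * L)) * (m * m)%:R.
  rewrite natrM -expr2; apply: bipartite_exponent m_ge => //.
  apply: le_trans (expR_ge1Dx _).
  move: L3; rewrite ler_pdivrMr ?divr_gt0// [L * _]mulrC.
  by move=> /le_trans; apply; rewrite lerDr.
have [B1 [mB1 PB1 HB1]] := sparse_sum_le hX (@hlaw n) (hind n) n0 eps0.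
have [B2 [mB2 PB2 HB2]] := all_edges_ge hX (@hlaw n) (hind n) n0.
have [B3 [mB3 PB3 HB3]] := bipartite_heavy (@hlaw n) (hind n) m
  (expR_ge0 _) (HL0 L LL0).
rewrite -LE in PB1 HB1 HB2.
have mB : measurable (B1 `|` B2 `|` B3) by do 2 apply: measurableU => //.
apply: (prob_compl_sub _ mB); first exact: measurable_max_weight_itv.
- move=> w /= /not_orP[/not_orP[nB1 nB2] nB3].
  have {}HB1 := HB1 w nB1; have {}HB2 := HB2 w nB2; have {}HB3 := HB3 w nB3.
  rewrite (rate_invE hX) -!EFinM; apply/andP; split; last first.
    apply: max_weight_le => H CH.
    apply: le_trans (HB1 _ (edges_complete H) (Cn _ _ CH)) _.
    rewrite mulrCA ler_wpM2l ?(ltW nR)//; apply: rinv_scale => //.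
    by rewrite lerDl ltW.
  pose v0 : 'I_n := Ordinal n0.
  pose v1 : 'I_n := Ordinal (ltn_trans (isT : 1 < 2)%N n3).
  pose r u v := (1 - eps / 2) * rinv X L <= Xe n [set u; v]%SET w.
  have r_sym : symmetric r by move=> u v; rewrite /r finset.setUC.
  have v01 : v0 != v1 by [].
  have [s [us lasts sT [E [Es cE rE]]]] := hamilton_path_heavy v01 r_sym HB3.
  have [H [CH sH]] := Cham n v0 v1 s n3 erefl erefl us lasts sT.
  apply: (max_weight_ge CH).
  rewrite card_ord in cE.
  apply: le_trans (heavy_sum (fintype.subset_trans Es sH) (edges_complete H)
    (Cn _ _ CH) cE (_ : 0 <= (1 - eps / 2) * rinv X L) (rinv_ge0 hX (3 * L)) _ HB2).
  - apply: linear_weight_bound => //.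
    + by apply: rinv_scale => //; rewrite ler1n.
    + rewrite natrD -addnn natrD.
      by move: (eps * n%:R) m_le => t; lra.
  - by rewrite mulr_ge0//; lra.
  - by move=> f /rE[u [v [-> ]]].
apply: le_trans (measureU2 _ (measurableU _ _ mB1 mB2) mB3) _.
have tn : 3 * n%:R^-1 <= e by rewrite ler_pdivrMr// mulrC -ler_pdivrMr.
apply: (@le_trans _ _ (n%:R^-1 + n%:R^-1 + n%:R^-1)%:E); last first.
  by rewrite lee_fin; lra.
rewrite !EFinD; apply: leeD.
  apply: le_trans (measureU2 _ mB1 mB2) _; apply: leeD => //.
  apply: le_trans PB1 _; rewrite lee_fin; apply: le_trans (expRN_le_inv nR).
  rewrite ler_expR -[leRHS]mulrN1 ler_wpM2l ?(ltW nR)//.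
  by move: (eps * L) epsL => t; lra.
apply: le_trans PB3 _; rewrite lee_fin; apply: le_trans (expRN_le_inv nR).
rewrite ler_expR; move: (_ * (m * m)%:R) pm => t; lra.
Unshelve. all: by end_near. Qed.

Lemma spanning_trees_card n (H : graph 'I_n) :
  @spanning_trees n H -> (#|edges H| <= n)%N.
Proof. by move=> [_ /card_edges_tree]; rewrite card_ord. Qed.

Lemma hamilton_cycles_card n (H : graph 'I_n) :
  @hamilton_cycles n H -> (#|edges H| <= n)%N.
Proof. by move=> [_ /card_edges_cycle]; rewrite card_ord. Qed.

Lemma paths_1_to_2_card n (H : graph 'I_n) :
  @paths_1_to_2 n H -> (#|edges H| <= n)%N.
Proof. by move=> [x [y [_ _ /card_edges_path]]]; rewrite card_ord. Qed.

Lemma spanning_trees_hamilton n (v0 v1 : 'I_n) s : uniq (v0 :: s) ->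
  [set:: v0 :: s]%SET = [set: 'I_n]%SET ->
  exists H, spanning_trees H /\ walk_edges v0 s \subset edges H.
Proof.
move=> us sT; have [G [VG EG]] := path_graph us; exists G.
rewrite EG; split => //; split; first by rewrite /spanning VG.
exact: is_tree_walk us VG EG.
Qed.

Lemma hamilton_cycles_hamilton n (v0 v1 : 'I_n) s : (3 <= n)%N ->
  uniq (v0 :: s) -> [set:: v0 :: s]%SET = [set: 'I_n]%SET ->
  exists H, hamilton_cycles H /\ walk_edges v0 s \subset edges H.
Proof.
move=> n3 us sT; have ss : (3 <= size (v0 :: s))%N.
  by rewrite -(card_uniqP us) -cardsE sT cardsT card_ord.
have [C [cC VC EC]] := cycle_graph us ss; exists C.
by rewrite EC finset.subsetUr; split => //; split => //; rewrite /spanning VC.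
Qed.

Lemma paths_1_to_2_hamilton n (v0 v1 : 'I_n) s : v0 = 0%N :> nat ->
  v1 = 1%N :> nat -> uniq (v0 :: s) -> last v0 s = v1 ->
  exists H, paths_1_to_2 H /\ walk_edges v0 s \subset edges H.
Proof.
move=> v00 v11 us lasts; have [G [VG EG]] := path_graph us; exists G.
rewrite EG; split => //; exists v0, v1; split => //.
by exists s; split.
Qed.

(** * Copies of a balanced graph *)

(* [emb g] sends the vertex of rank [r] to position [g] of the [r]-th block of
   [m] consecutive vertices. *)
Lemma block_embedding (V : finType) (m n : nat) : (#|V| * m <= n)%N ->
  exists emb : {ffun V -> 'I_m} -> V -> 'I_n,
  forall g g' i j, emb g i = emb g' j -> i = j /\ g i = g' i.
Proof.
move=> Vmn.
have lt_n (g : {ffun V -> 'I_m}) i : (enum_rank i * m + g i < n)%N.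
  apply: leq_trans Vmn; apply: (@leq_trans ((enum_rank i).+1 * m)).
    by rewrite mulSn addnC ltn_add2r.
  by rewrite leq_mul2r ltn_ord orbT.
exists (fun g i => Ordinal (lt_n g i)) => g g' i j [] E.
have m0 : (0 < m)%N by exact: leq_ltn_trans (ltn_ord (g i)).
have ij : i = j.
  apply: enum_rank_inj; apply/val_inj => /=.
  have := congr1 (fun k => k %/ m)%N E.
  by rewrite !divnMDl// !divn_small ?addn0.
by split => //; apply/val_inj => /=; move: E; rewrite -ij => /addnI.
Qed.

Section Copies.
Context (V : finType) (H0 : graph V).
Hypothesis H0_balanced : balanced H0.
Hypothesis H0_edges : (1 <= #|edges H0|)%N.

Definition copy_edges (I : finType) (f : V -> I) : {set {set I}} :=
  [set [set f x | x in e] | e : {set V} in edges H0]%SET.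

Definition induced_edges (A : {set V}) : {set {set V}} :=
  [set e in edges H0 | e \subset A]%SET.

Lemma vertices_gt0 : (0 < #|vertices H0|)%N.
Proof.
have /card_gt0P[e eH] := H0_edges.
by apply: leq_trans (subset_leq_card (edge_sub eH)); rewrite (edge_card eH).
Qed.

Lemma densityE (R : realType) :
  ratr (density H0) = #|edges H0|%:R / #|vertices H0|%:R :> R.
Proof. by rewrite /density fmorph_div !rmorph_nat. Qed.

Lemma density_gt0 (R : realType) : 0 < ratr (density H0) :> R.
Proof. by rewrite densityE divr_gt0 ?ltr0n ?vertices_gt0. Qed.

(** A may contain points outside H0, since block embeddings are defined on all of V; balancedness is
    applied to the part of A inside H0. If that part is empty, its density is 0 / 0 = 0 and says
    nothing, but then there is no induced edge. *)
Lemma balanced_induced (R : realType) (A : {set V}) :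
  #|induced_edges A|%:R <= ratr (density H0) * #|A|%:R :> R.
Proof.
have wf : wf_graph ((A :&: vertices H0)%SET, induced_edges A).
  apply/forall_inP => e /=; rewrite inE => /andP[eH eA].
  by rewrite (edge_card eH) eqxx finset.subsetI eA edge_sub.
have := H0_balanced (H := Graph wf).
have -> : subgraph (Graph wf) H0.
  rewrite /subgraph /vertices /edges /= finset.subsetIr /=.
  by apply/fintype.subsetP => e; rewrite inE => /andP[].
move=> /(_ isT); rewrite -(ler_rat R); set dR := ratr (density H0).
rewrite /density fmorph_div !rmorph_nat /vertices /edges /=.
have dR0 : 0 <= dR by exact/ltW/density_gt0.
have cA : #|(A :&: vertices H0)%SET|%:R <= #|A|%:R :> R.
  by rewrite ler_nat subset_leq_card// finset.subsetIl.
have [c0|c0] := posnP #|(A :&: vertices H0)%SET|; last first.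
  rewrite ler_pdivrMr ?ltr0n// => /le_trans; apply.
  by rewrite ler_wpM2l.
move=> _; have -> : induced_edges A = finset.set0.
  apply/eqP; rewrite -finset.subset0; apply/fintype.subsetP => e.
  rewrite inE => /andP[eH eA].
  have := subset_leq_card (_ : e \subset A :&: vertices H0)%SET.
  by rewrite finset.subsetI eA edge_sub// (edge_card eH) c0 => /(_ isT).
by rewrite cards0 mulr_ge0.
Qed.

Section FixedSize.
Context (R : realType) (d0 : measure_display) (T0 : measurableType d0)
  (P0 : probability T0 R) (X : {RV P0 >-> R}).
Hypothesis X_good : good P0 X.
Context (d : measure_display) (T : measurableType d) (P : probability T R).
Variables (n : nat) (Y : {set 'I_n} -> {RV P >-> R}).
Let J := edges (complete_graph 'I_n).
Hypothesis law : forall e, e \in J -> same_law P (Y e) P0 X.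
Hypothesis ind : independent P J (fun e => Y e : T -> R).
Hypothesis n_gt0 : (0 < n)%N.

(** Maps are normalised to be constant off the vertices of H0, so that they number n to the power of
    the vertex count of H0 rather than of V. A map that is not injective may merge edges, which
    Chernoff's bound for at most N edges permits. *)
Lemma copies_sum_le (L : R) : exists B, [/\ measurable B,
    (P B <= (n%:R ^+ #|vertices H0| * expR (- (#|edges H0|%:R * L)))%:E)%E
    & forall w, ~ B w -> forall H, copies H0 H ->
        \sum_(e in edges H) Y e w <= #|edges H0|%:R * rinv X L].
Proof.
pose x0 : 'I_n := Ordinal n_gt0.
set b := #|edges H0|%:R * rinv X L.
pose Q (f : {ffun V -> 'I_n}) :=
  (f \in pffun_on x0 (mem (vertices H0)) predT) && (copy_edges f \subset J).
pose A (f : {ffun V -> 'I_n}) := [set w | b < \sum_(e in copy_edges f) Y e w].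
have mA f : measurable (A f).
  apply: measurable_gt.
  by under eq_fun do rewrite -big_enum/=; exact: measurable_sum.
have PA f : Q f -> (P (A f) <= (expR (- (#|edges H0|%:R * L)))%:E)%E.
  move=> /andP[_ fJ].
  by apply: (chernoff_sum X_good L ind law fJ) => //; exact: leq_imset_card.
have [mB PB] := union_bound (fun f _ => mA f) PA.
exists [set w | exists f, Q f /\ A f w]; split => //.
  apply: le_trans PB _; rewrite lee_fin sumr_const -[leLHS]mulr_natl.
  rewrite ler_wpM2r ?expR_ge0// -natrX ler_nat.
  apply: (@leq_trans #|pffun_on x0 (mem (vertices H0)) (predT : pred 'I_n)|).
    by apply: subset_leq_card; apply/fintype.subsetP => f /andP[].
  by rewrite card_pffun_on card_ord.
move=> w nB H [f [f_inj VH EH]]; rewrite leNgt; apply/negP => bH; apply: nB.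
pose f' : {ffun V -> 'I_n} := [ffun i => if i \in vertices H0 then f i else x0].
have EH' : edges H = copy_edges f'.
  rewrite EH; apply: eq_in_imset => e /edge_sub /fintype.subsetP eV.
  by apply: eq_in_imset => i /eV iV; rewrite ffunE iV.
exists f'; split; last by rewrite /A/= -EH'.
rewrite /Q -EH' edges_complete andbT; apply/pffun_onP; split => //.
by apply/supportP => i iV; rewrite ffunE (negPf iV).
Qed.

Lemma all_ge_indep (h p : R) (F : {set {set 'I_n}}) :
  P0 [set w | h <= X w] = p%:E -> F \subset J ->
  P [set w | forall e, e \in F -> `[h, +oo[%classic (Y e w)] = (p ^+ #|F|)%:E.
Proof.
move=> hp FJ; rewrite (ind (B := fun=> `[h, +oo[%classic) FJ)//.
rewrite (eq_bigr (fun=> p%:E)); first by rewrite prodEFin prodr_const.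
move=> e eF; rewrite law//; last exact: (fintype.subsetP FJ).
rewrite -hp; congr (P0 _); apply/seteqP.
by split => w /=; rewrite in_itv/= andbT.
Qed.

(* Second moment method over the block embeddings of [H0].  Two copies can share
   an edge only where their embeddings agree, and agreement on [A] costs a factor
   at most [x ^ #|A|]; balancedness gives the last hypothesis with [x = n ^ (1 - c)]. *)
Lemma heavy_copy_exists (h p x : R) (m : nat) :
  P0 [set w | h <= X w] = p%:E -> 0 < p -> p <= 1 -> 0 < x -> (0 < m)%N ->
  (#|V| * m <= n)%N ->
  (forall A : {set V}, 1 <= p ^+ #|induced_edges A| * x ^+ #|A|) ->
  exists B, [/\ measurable B, (P B <= ((1 + x / m%:R) ^+ #|V| - 1)%:E)%E
    & forall w, ~ B w -> exists H, copies H0 H /\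
        #|edges H0|%:R * h <= \sum_(e in edges H) Y e w].
Proof.
move=> hp p0 p1 x0 m0 Vmn px.
have [emb embP] := block_embedding Vmn.
have emb_inj g : injective (emb g) by move=> i j /embP[].
pose E g := copy_edges (emb g).
have EJ g : E g \subset J.
  apply/fintype.subsetP => _ /imsetP[e eH ->].
  by rewrite inE card_imset// (edge_card eH).
have cE g : #|E g| = #|edges H0|.
  by rewrite card_in_imset// => e e' _ _; exact: imset_inj.
pose A g := [set w | forall e, e \in E g -> `[h, +oo[%classic (Y e w)].
have mA g : measurable (A g).
  by apply: (measurable_all_in (E g) Y (B := fun=> `[h, +oo[%classic)).
pose agree (g g' : {ffun V -> 'I_m}) := [set i | g i == g' i]%SET.
have EI g g' : (#|(E g :&: E g')%SET| <= #|induced_edges (agree g g')|)%N.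
  rewrite -(card_imset _ (imset_inj (emb_inj g))).
  apply: subset_leq_card; apply/fintype.subsetP => e'.
  rewrite finset.in_setI => /andP[/imsetP[e eH ->] /imsetP[e2 e2H e12]].
  apply/imsetP; exists e => //; rewrite inE eH.
  apply/fintype.subsetP => i ie; have : emb g i \in [set emb g' x | x in e2]%SET.
    by rewrite -e12 imset_f.
  by move=> /imsetP[j _ /embP[_ gg']]; rewrite inE gg'.
have PA g : fine (P (A g)) = p ^+ #|edges H0|.
  by rewrite /A (all_ge_indep hp (EJ g)) cE.
(* The union of the two edge sets falls short of twice the edges of H0 by the common edges. The
   missing factors of p are paid for by x at the points of agreement, through [px]. *)
have PAA g g' : fine (P (A g `&` A g')) <=
    p ^+ (2 * #|edges H0|) * x ^+ #|agree g g'|.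
  have -> : A g `&` A g' =
      [set w | forall e, e \in (E g :|: E g')%SET -> `[h, +oo[%classic (Y e w)].
    apply/seteqP; split => w /=.
      by move=> [H1 H2] e /finset.setUP[]; [exact: H1|exact: H2].
    by move=> H; split=> e eE; apply: H; rewrite finset.in_setU eE ?orbT.
  rewrite (all_ge_indep hp); last by rewrite finset.subUset !EJ.
  have cU : (#|(E g :|: E g')%SET| + #|(E g :&: E g')%SET| = 2 * #|edges H0|)%N.
    by rewrite finset.cardsUI !cE addnn mul2n.
  rewrite -cU exprD -mulrA ler_peMr ?exprn_ge0 ?(ltW p0)//.
  apply: le_trans (px (agree g g')) _.
  by rewrite ler_wpM2r ?exprn_ge0 ?(ltW x0)// ler_wiXn2l ?(ltW p0)// EI.
(* The sum over g' factors over the points of V, each contributing x for agreement and 1 for each of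
   the m - 1 other positions. *)
have sum_agree g : \sum_g' x ^+ #|agree g g'| <= (x + m%:R) ^+ #|V|.
  rewrite (eq_bigr (fun g' : {ffun V -> 'I_m} =>
      \prod_i (if g i == g' i then x else 1))); last first.
    move=> g' _; rewrite -big_mkcond/= -prodr_const.
    by apply: eq_bigl => i; rewrite inE.
  rewrite -(bigA_distr_bigA (fun i j => if g i == j then x else 1))/=.
  rewrite -prodr_const; apply: ler_prod => i _.
  rewrite (bigD1 (g i))//= eqxx (eq_bigr (fun=> 1)); last first.
    by move=> j /negPf; rewrite eq_sym => ->.
  rewrite sumr_const cardC1 card_ord addr_ge0 ?(ltW x0)//= lerD2l ler_nat.
  exact: leq_pred.
pose mu := m%:R ^+ #|V| * p ^+ #|edges H0|.
have mR : 0 < m%:R :> R by rewrite ltr0n.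
have mu0 : 0 < mu by rewrite mulr_gt0 ?exprn_gt0.
have sumA : \sum_g fine (P (A g)) = mu.
  rewrite (eq_bigr _ (fun g _ => PA g)) sumr_const card_ffun card_ord.
  by rewrite -[LHS]mulr_natl natrX.
have sumAA : \sum_g \sum_g' fine (P (A g `&` A g')) <=
    m%:R ^+ #|V| * (p ^+ (2 * #|edges H0|) * (x + m%:R) ^+ #|V|).
  apply: (@le_trans _ _ (\sum_(g : {ffun V -> 'I_m})
      p ^+ (2 * #|edges H0|) * (x + m%:R) ^+ #|V|)).
    apply: ler_sum => g _; apply: le_trans (ler_sum _ (fun g' _ => PAA g g')) _.
    by rewrite -mulr_sumr ler_wpM2l// exprn_ge0// ltW.
  by rewrite sumr_const card_ffun card_ord -[leLHS]mulr_natl natrX.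
have PB := second_moment mA mu0 sumA sumAA.
exists [set w | forall g, ~ A g w]; split.
- rewrite (_ : mkset _ = \bigcap_(g in [set: {ffun V -> 'I_m}]) ~` A g).
    apply: fin_bigcap_measurable; first exact: finite_finset.
    by move=> g _; exact: measurableC.
  by apply/seteqP; split => w H g; [move=> _; exact: H|exact: H].
- apply: le_trans PB _; rewrite lee_fin lerB// le_eqVlt; apply/orP; left.
  apply/eqP; have -> : 1 + x / m%:R = (x + m%:R) / m%:R.
    by field; rewrite gt_eqF.
  rewrite expr_div_n /mu mul2n -addnn exprD.
  have a0 : m%:R ^+ #|V| != 0 :> R by rewrite expf_neq0// gt_eqF.
  have b0 : p ^+ #|edges H0| != 0 by rewrite expf_neq0// gt_eqF.
  move: (m%:R ^+ #|V|) (p ^+ #|edges H0|) ((x + m%:R) ^+ #|V|) a0 b0 => a b c.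
  by move=> a0 b0; field; rewrite a0 b0.
move=> w /existsNP[g /contrapT Ag].
have wf : wf_graph ([set emb g i | i in vertices H0]%SET, E g).
  apply/forall_inP => _ /imsetP[e eH ->] /=.
  by rewrite card_imset// (edge_card eH) eqxx imsetS// edge_sub.
exists (Graph wf); split; first by exists (emb g); split => // i j _ _ /emb_inj.
rewrite /edges /=; apply: (@le_trans _ _ (\sum_(e in E g) h)).
  by rewrite sumr_const cE -[leRHS]mulr_natl.
by apply: ler_sum => e /Ag /=; rewrite in_itv/= andbT.
Qed.

End FixedSize.

End Copies.

(** Here [expR ((1 - c) * ln n) / m] is of order [n ^ (- c)], since m is at least [n / (2 k)]. The
    crude bound [n ^ (- c) <= 1 / (c ln n)] makes the threshold on n explicit. *)
Lemma second_moment_exponent (R : realType) (k n m : nat) (c e : R) :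
  0 < c -> 0 < e -> (0 < k)%N -> (2 * k <= n)%N -> m = (n %/ k)%N ->
  2 * k%:R ^+ 2 / (c * ln (1 + e)) <= ln n%:R ->
  (1 + expR ((1 - c) * ln n%:R) / m%:R) ^+ k - 1 <= e.
Proof.
move=> c0 e0 k0 kn mE Ln; set L : R := ln n%:R.
have n0 : (0 < n)%N by lia.
have nR : 0 < n%:R :> R by rewrite ltr0n.
have kR : 0 < k%:R :> R by rewrite ltr0n.
have m0 : (0 < m)%N by rewrite mE divn_gt0//; lia.
have mR : 0 < m%:R :> R by rewrite ltr0n.
have l0 : 0 < ln (1 + e) by rewrite ln_gt0// ltrDl.
have L0 : 0 < L.
  by apply: lt_le_trans Ln; rewrite divr_gt0 ?mulr_gt0 ?exprn_gt0.
have nm : n%:R <= 2 * k%:R * m%:R :> R.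
  rewrite -!natrM ler_nat mE; have := divn_eq n k; have := ltn_pmod n k0.
  by move: (n %/ k)%N (n %% k)%N => q r; nia.
set x := expR _; have x0 : 0 < x by exact: expR_gt0.
have xL : x <= n%:R / (c * L).
  have -> : x = n%:R * expR (- (c * L)).
    rewrite -[n%:R](lnK (x := n%:R)) ?posrE// -expRD /x -/L; congr expR; ring.
  by rewrite ler_wpM2l ?(ltW nR)//; apply: expRN_le_inv; rewrite mulr_gt0.
rewrite lerBlDr [e + 1]addrC; apply: (@le_trans _ _ (expR (x / m%:R) ^+ k)).
  by rewrite lerXn2r ?nnegrE ?expR_ge0 ?expR_ge1Dx// addr_ge0// divr_ge0// ltW.
rewrite -expRM_natl -[leRHS]lnK; last by rewrite posrE addr_gt0.
rewrite ler_expR mulrA ler_pdivrMr//.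
have cL : 0 < c * L by rewrite mulr_gt0.
apply: (@le_trans _ _ (k%:R * (n%:R / (c * L)))); first by rewrite ler_wpM2l.
rewrite mulrA ler_pdivrMr//.
apply: (@le_trans _ _ (k%:R * (2 * k%:R * m%:R))); first by rewrite ler_wpM2l.
have : 2 * k%:R ^+ 2 <= ln (1 + e) * (c * L).
  by move: Ln; rewrite ler_pdivrMr ?mulr_gt0// mulrCA mulrA [L * _]mulrC mulrA
    [ln _ * c]mulrC.
move=> H; have -> : k%:R * (2 * k%:R * m%:R) = 2 * k%:R ^+ 2 * m%:R :> R by ring.
by rewrite [leRHS]mulrAC ler_wpM2r// ltW.
Qed.

Lemma whp_copies (R : realType)
    (d0 : measure_display) (T0 : measurableType d0) (P0 : probability T0 R)
    (X : {RV P0 >-> R}) (hX : good P0 X)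
    (d : nat -> measure_display) (T : forall n, measurableType (d n))
    (P : forall n, probability (T n) R)
    (Xe : forall n, {set 'I_n} -> {RV (P n) >-> R})
    (hlaw : forall n (e : {set 'I_n}), e \in edges (complete_graph 'I_n) ->
       same_law (P n) (Xe n e) P0 X)
    (hind : forall n, independent (P n) (edges (complete_graph 'I_n))
       (fun e => Xe n e : T n -> R))
    (V : finType) (H0 : graph V) :
  balanced H0 -> (1 <= #|edges H0|)%N ->
  whp_asymptotic P (fun n w => max_weight (@copies V H0 n) (fun e => Xe n e w))
    (fun n => (#|edges H0|%:R%:E *
      rate_inv P0 X ((ratr (density H0))^-1 * ln n%:R))%E).
Proof.
move=> bal He; apply: whp_asymptotic_of_forall.
  by move=> n x y; exact: measurable_max_weight_itv.
move=> eps e /andP[eps0 eps1] e0.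
have [L0 HL0] := @tail_ge_rinv _ _ _ _ _ hX eps (introT andP (conj eps0 eps1)).
set dR : R := ratr (density H0).
have dR0 : 0 < dR by exact: density_gt0.
pose l : R := #|edges H0|%:R; have l0 : 0 < l by rewrite ltr0n.
have v0 := vertices_gt0 He.
have V0 : (0 < #|V|)%N by exact: leq_trans v0 (max_card _).
(* This identity fixes the scale [ln n / dR]: at that L, the Chernoff factor [expR (- (l * L))]
   exactly cancels the number of maps, and the slack leaves [n ^ (- eps v)] with v vertices. *)
have ldR : l / dR = #|vertices H0|%:R.
  by rewrite /dR densityE /l; field; rewrite !gt_eqF// ltr0n.
near=> n.
have nV : (2 * #|V| <= n)%N by near: n; exact: nbhs_infty_ge.
have Vn : (#|V| <= n)%N by apply: leq_trans nV; exact: leq_pmull.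
have n0 : (0 < n)%N by exact: leq_trans Vn.
have nR : 0 < n%:R :> R by rewrite ltr0n.
have L1 : dR * L0 <= ln n%:R by near: n; exact: near_ln_ge.
have L2 : 2 / (eps * e) <= ln n%:R by near: n; exact: near_ln_ge.
have L3 : 2 * #|V|%:R ^+ 2 / (eps / 4 * ln (1 + e / 2)) <= ln n%:R.
  by near: n; exact: near_ln_ge.
have ln0 : 0 < ln n%:R :> R by apply: lt_le_trans L2; rewrite divr_gt0 ?mulr_gt0.
have [L LE] : exists L, L = dR^-1 * ln n%:R by exists (dR^-1 * ln n%:R).
rewrite -LE; have LL0 : L0 <= L by rewrite LE ler_pdivlMl.
have Lln : dR * L = ln n%:R by rewrite LE mulrA mulfV ?gt_eqF// mul1r.
have [p pE] : exists p, P0 [set w | (1 - eps) * rinv X L <= X w] = p%:E.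
  exists (fine (P0 [set w | (1 - eps) * rinv X L <= X w])); rewrite fineK//.
  by apply: fin_num_measure; exact: measurable_ge (measurable_funP X).
have := HL0 L LL0; rewrite pE lee_fin => p_ge.
have p0 : 0 < p by exact: lt_le_trans (expR_gt0 _) p_ge.
have p1 : p <= 1.
  rewrite -lee_fin -pE; apply: probability_le1.
  exact: measurable_ge (measurable_funP X).
pose m := (n %/ #|V|)%N.
have m0 : (0 < m)%N by rewrite divn_gt0.
have Vm : (#|V| * m <= n)%N by rewrite mulnC leq_trunc_div.
pose x : R := expR ((1 - eps / 4) * ln n%:R).
(* The product is at least [n ^ ((1 - eps / 4) (a - b / dR))] with a points and b induced edges, and
   balancedness makes this exponent nonnegative. *)
have px (A : {set V}) : 1 <= p ^+ #|induced_edges H0 A| * x ^+ #|A|.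
  apply: (@le_trans _ _ (expR (- ((1 - eps / 4) * L)) ^+ #|induced_edges H0 A|
      * x ^+ #|A|)); last first.
    by rewrite ler_wpM2r ?exprn_ge0 ?expR_ge0// lerXn2r// nnegrE ?expR_ge0// ltW.
  rewrite -!expRM_natl -expRD -[leLHS](expR0 R) ler_expR -Lln.
  have := balanced_induced bal He R A; rewrite -/dR => bA.
  have L_ge0 : 0 <= (1 - eps / 4) * L.
    rewrite mulr_ge0//; first by lra.
    by rewrite LE mulr_ge0 ?invr_ge0 ?ltW.
  have : 0 <= (1 - eps / 4) * L * (dR * #|A|%:R - #|induced_edges H0 A|%:R).
    by rewrite mulr_ge0// subr_ge0.
  move: (#|A|%:R) (#|induced_edges H0 A|%:R) => a b; lra.
have [B1 [mB1 PB1 HB1]] := copies_sum_le He hX (@hlaw n) (hind n) n0 ((1 + eps) * L).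
have [B2 [mB2 PB2 HB2]] :=
  heavy_copy_exists (@hlaw n) (hind n) pE p0 p1 (expR_gt0 _) m0 Vm px.
apply: (prob_compl_sub _ (measurableU _ _ mB1 mB2)).
- exact: measurable_max_weight_itv.
- move=> w /= /not_orP[nB1 nB2].
  rewrite (rate_invE hX) -!EFinM; apply/andP; split.
    have [H [CH sH]] := HB2 w nB2; apply: (max_weight_ge CH).
    by apply: le_trans sH; rewrite mulrCA.
  apply: max_weight_le => H CH; apply: le_trans (HB1 w nB1 H CH) _.
  rewrite mulrCA ler_wpM2l//; apply: rinv_scale => //.
  by rewrite lerDl ltW.
apply: le_trans (measureU2 _ mB1 mB2) _.
have -> : e = e / 2 + e / 2 by field.
rewrite EFinD; apply: leeD.
  apply: le_trans PB1 _; rewrite lee_fin.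
  have lL : l * L = #|vertices H0|%:R * ln n%:R.
    by rewrite LE mulrA ldR.
  have -> : n%:R ^+ #|vertices H0| = expR (#|vertices H0|%:R * ln n%:R) :> R.
    by rewrite expRM_natl lnK ?posrE.
  rewrite -/l -expRD mulrCA lL.
  apply: (@le_trans _ _ (expR (- (eps * ln n%:R)))).
    rewrite ler_expR; move: (ln n%:R) ln0 => t t0.
    have : 0 <= eps * t * (#|vertices H0|%:R - 1).
      by rewrite !mulr_ge0 ?(ltW eps0) ?(ltW t0)// subr_ge0 ler1n.
    by move: (#|vertices H0|%:R) => v; lra.
  apply: le_trans (expRN_le_inv _) _; first by rewrite mulr_gt0.
  rewrite -[e / 2]invrK invf_div lef_pV2 ?posrE ?mulr_gt0 ?invr_gt0//.
  by rewrite ler_pdivrMr// [eps * _]mulrC -mulrA -ler_pdivrMr ?mulr_gt0.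
apply: le_trans PB2 _; rewrite lee_fin.
by apply: (second_moment_exponent (c := eps / 4)) L3; rewrite ?divr_gt0.
Unshelve. all: by end_near. Qed.

Theorem theorem2 (R : realType)
    (d0 : measure_display) (T0 : measurableType d0) (P0 : probability T0 R)
    (X : {RV P0 >-> R}) (hX : good P0 X)
    (d : nat -> measure_display) (T : forall n, measurableType (d n))
    (P : forall n, probability (T n) R)
    (Xe : forall n, {set 'I_n} -> {RV (P n) >-> R})
    (hlaw : forall n (e : {set 'I_n}), e \in edges (complete_graph 'I_n) ->
       same_law (P n) (Xe n e) P0 X)
    (hind : forall n, independent (P n) (edges (complete_graph 'I_n))
       (fun e => Xe n e : T n -> R)) :
  let W (C : forall n, set (graph 'I_n)) (n : nat) (w : T n) : \bar R :=
    max_weight (C n) (fun e => Xe n e w) in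
  [/\ whp_asymptotic P (W spanning_trees)
        (fun n => (n%:R%:E * rate_inv P0 X (ln n%:R))%E),
      whp_asymptotic P (W hamilton_cycles)
        (fun n => (n%:R%:E * rate_inv P0 X (ln n%:R))%E),
      whp_asymptotic P (W paths_1_to_2)
        (fun n => (n%:R%:E * rate_inv P0 X (ln n%:R))%E)
    & forall (V0 : finType) (H0 : graph V0), balanced H0 ->
        (1 <= #|edges H0|)%N ->
        whp_asymptotic P (W (copies H0))
          (fun n => (#|edges H0|%:R%:E *
             rate_inv P0 X ((ratr (density H0))^-1 * ln n%:R))%E)].
Proof.
move=> W; split.
- apply: (whp_linear hX hlaw hind); first exact: spanning_trees_card.
  by move=> n v0 v1 s _ _ _ us _ sT; exact: spanning_trees_hamilton.
- apply: (whp_linear hX hlaw hind); first exact: hamilton_cycles_card.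
  by move=> n v0 v1 s n3 _ _ us _ sT; exact: hamilton_cycles_hamilton.
- apply: (whp_linear hX hlaw hind); first exact: paths_1_to_2_card.
  by move=> n v0 v1 s _ v00 v11 us ls _; exact: (paths_1_to_2_hamilton v00 v11).
- by move=> V H0 bal He; exact: whp_copies.
Qed.
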